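(* For the poset $\mathcal A_q(N,M)$, the matrix $A^*$ is a dual adjacency matrix for each of the following orderings of the eigenspaces of $A$: (i) $E_0V<E_1V<E_2V<\cdots<E_NV<E_{1/2}V<E_{3/2}V<\cdots<E_{N-1/2}V$; (ii) $E_{1/2}V<E_{3/2}V<\cdots<E_{N-1/2}V<E_0V<E_1V<E_2V<\cdots<E_NV$.
   Context: Let $\mathbb F_q$ be a finite field with $q$ elements, let $N,M$ be positive integers, let $H$ be a vector space over $\mathbb F_q$ of dimension $N+M$, and fix a subspace $h\subseteq H$ of dimension $M$. Let $X$ be the set of subspaces $y\subseteq H$ with $y\cap h=0$, partially ordered by inclusion (the Attenuated Space poset $\mathcal A_q(N,M)$). For $y,z\in X$, $z$ covers $y$ when $y\subseteq z$ and $\dim z-\dim y=1$; $y,z$ are adjacent when one of them covers the other. Let $\mathrm{Mat}_X(\mathbb C)$ be the algebra of complex matrices with rows and columns indexed by $X$, acting on $V=\mathbb C^X$ by left multiplication. The matrix $A\in\mathrm{Mat}_X(\mathbb C)$ has $(y,z)$-entry $1$ if $y$ covers $z$; $q^{\dim y}$ if $z$ covers $y$; and $0$ if $y,z$ are not adjacent. The matrix $A^*\in\mathrm{Mat}_X(\mathbb C)$ is diagonal with $(y,y)$-entry $q^{-\dim y}$. Let $[N]=\{i: 2i\in\mathbb Z,\ 0\le i\le N\}=\{0,1/2,1,\ldots,N\}$. The matrix $A$ is diagonalizable with mutually distinct eigenvalues $\theta_i=\frac{q^{N-i}-q^i}{q-1}q^{M/2}$ $(i\in[N])$, where $q^{1/2}>0$.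 For $i\in[N]$, $E_i$ is the primitive idempotent of $A$ for $\theta_i$ (the projection acting as the identity on the $\theta_i$-eigenspace and as $0$ on the other eigenspaces), so $E_iV$ is the $\theta_i$-eigenspace of $A$. For $0\le i\le N$ let $E^*_i\in\mathrm{Mat}_X(\mathbb C)$ be the diagonal matrix with $(y,y)$-entry $1$ if $\dim y=i$ and $0$ otherwise. Let $\mathbf M^*$ be the commutative subalgebra of $\mathrm{Mat}_X(\mathbb C)$ with basis $\{E^*_i\}_{i=0}^N$. Set $D=2N$. For an ordering $\{V_i\}_{i=0}^D$ of the eigenspaces of $A$, a dual adjacency matrix for this ordering is a matrix $\mathbf A^*$ that generates $\mathbf M^*$ and satisfies $\mathbf A^*V_i\subseteq V_{i-1}+V_i+V_{i+1}$ for $0\le i\le D$, where $V_{-1}=0$ and $V_{D+1}=0$. *)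

(* Defs.v *)
From HB Require Import structures.
From mathcomp Require Import all_boot all_order all_algebra.
From mathcomp Require Import complex reals.

Set Implicit Arguments.
Unset Strict Implicit.
Unset Printing Implicit Defensive.

Import Order.TTheory GRing.Theory Num.Theory.
Local Open Scope ring_scope.
Local Open Scope complex_scope.

(* The subType structure of {vspace H} is only visible after importing
   VectorInternalTheory. *)
Section FiniteVspace.
Import VectorInternalTheory.
Variables (F : finFieldType) (H : vectType F).
HB.instance Definition _ := [Countable of {vspace H} by <:].
HB.instance Definition _ := [Finite of {vspace H} by <:].
End FiniteVspace.

Section LinearAlgebra.

Variables (C : fieldType) (n : nat).
Implicit Types (A B P : 'M[C]_n) (U W : {vspace 'cV[C]_n}).

Definition mxact A : 'End('cV[C]_n) := linfun (mulmx A).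

Definition mx_eigenspace A (a : C) : {vspace 'cV[C]_n} :=
  passmx.leigenspace (mxact A) a.

Definition mxim A : {vspace 'cV[C]_n} := (mxact A @: fullv)%VS.

Definition endo_mx (f : 'End('cV[C]_n)) : 'M[C]_n :=
  \matrix_(i, j) f (delta_mx j 0) i 0.

(* s lists every eigenspace of A (for an actual eigenvalue) exactly once. *)
Definition eigenspace_ordering A (s : seq {vspace 'cV[C]_n}) : Prop :=
  uniq s /\
  forall U, U \in s <->
    exists2 a : C, passmx.leigenvalue (mxact A) a & U = mx_eigenspace A a.

Definition subalgebra_mx (S : {vspace 'M[C]_n}) : Prop :=
  1%:M \in S /\ forall P B, P \in S -> B \in S -> P *m B \in S.

Definition generates B (S : {vspace 'M[C]_n}) : Prop :=
  [/\ subalgebra_mx S, B \in S &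
      forall T, subalgebra_mx T -> B \in T -> (S <= T)%VS].

(* With s = [:: V_0; ...; V_D], the three summands below are V_(i-1), V_i and
   V_(i+1): prefixing 0 to s encodes V_(-1) = 0, and the default value of nth
   encodes V_(D+1) = 0. *)
Definition dual_adjacency A (S : {vspace 'M[C]_n}) B
    (s : seq {vspace 'cV[C]_n}) : Prop :=
  [/\ eigenspace_ordering A s, generates B S &
      forall i, (i < size s)%N ->
        (mxact B @: nth 0%VS s i
          <= nth 0%VS (0%VS :: s) i + nth 0%VS s i + nth 0%VS s i.+1)%VS].

End LinearAlgebra.

Section AttenuatedSpace.

Variables (R : realType) (F : finFieldType) (H : vectType F) (h : {vspace H}).

Local Notation C := R[i].
Local Notation q := (#|F|%:R : C).

Definition att_space : finType := {y : {vspace H} | (y :&: h == 0)%VS}.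

Definition covers (z y : att_space) : bool :=
  (val y <= val z)%VS && (\dim (val z) == (\dim (val y)).+1).

(* Rows and columns are indexed by the poset through its enumeration. *)
Definition att_mx (f : att_space -> att_space -> C) : 'M[C]_#|att_space| :=
  \matrix_(i, j) f (enum_val i) (enum_val j).

Definition attA : 'M[C]_#|att_space| :=
  att_mx (fun y z =>
    if covers y z then 1
    else if covers z y then q ^+ \dim (val y)
    else 0).

Definition attAstar : 'M[C]_#|att_space| :=
  att_mx (fun y z => if y == z then q ^- \dim (val y) else 0).

Definition attEstar (i : nat) : 'M[C]_#|att_space| :=
  att_mx (fun y z => ((y == z) && (\dim (val y) == i))%:R).

Variables (N M : nat).

Definition attMstar : {vspace 'M[C]_#|att_space|} :=
  <<[seq attEstar i | i <- iota 0 N.+1]>>%VS.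

Definition sqrtq : C := (Num.sqrt (#|F|%:R : R))%:C.

(* An index i in {0, 1/2, 1, ..., N} is represented by the natural number
   k = 2i in {0, ..., 2N}; thus q^i = sqrtq ^+ k and
   q^(N-i) = sqrtq ^+ (2 * N - k). *)
Definition theta (k : nat) : C :=
  (sqrtq ^+ (2 * N - k) - sqrtq ^+ k) / (q - 1) * sqrtq ^+ M.

(* daddv_pi U W is the projection onto U along W; the theta j are pairwise
   distinct for j <= 2 * N, so that U and W below are disjoint. *)
Definition attE (k : nat) : 'M[C]_#|att_space| :=
  endo_mx (daddv_pi (mx_eigenspace attA (theta k))
    (\sum_(j < (2 * N).+1 | (j : nat) != k) mx_eigenspace attA (theta j))%VS).

Definition integral_part : seq {vspace 'cV[C]_#|att_space|} :=
  [seq mxim (attE (2 * i)) | i <- iota 0 N.+1].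

Definition half_integral_part : seq {vspace 'cV[C]_#|att_space|} :=
  [seq mxim (attE (2 * i).+1) | i <- iota 0 N].

End AttenuatedSpace.

(* Main.v *)
(** Write th t = (q^N / t - t) q^(M/2) / (q - 1), so that theta_i = th (q^i), and
    E t for the eigenspace of A for th t. A count of paths in the poset gives
    cubic relations between the raising and lowering parts of A, which combine
    into a tridiagonal relation between A and A*. As A is similar to a real
    symmetric matrix, it is diagonalizable, and the tridiagonal relation says
    that A* maps E t into E (t/q) + E t + E (tq).

    The sign matrix S = (-1)^dim is a polynomial of degree at most N in A*, and
    S A = - A S, so that S maps E t to E (q^N/t). Hence if E t <> 0 then
    q^N/t = t q^n for some integer n with |n| <= N, and th t is one of the
    theta_i. Conversely E 1 and E (q^(1/2)) contain explicit vectors, and if some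
    other eigenspace vanished, then the sum of the eigenspaces preceding it in
    its chain t, tq, tq^2, ... would be stable under A*, hence under S, which
    reverses the chain. *)
Require Import Defs.
From mathcomp Require Import all_boot all_order all_algebra all_field.
From mathcomp Require Import complex reals ring zify.

Set Implicit Arguments.
Unset Strict Implicit.
Unset Printing Implicit Defensive.

Import Order.TTheory GRing.Theory Num.Theory.
Local Open Scope ring_scope.
Local Open Scope complex_scope.

(** * Counting subspaces *)

Lemma card_vspace_set (F : finFieldType) (H : vectType F) (U : {vspace H}) :
  #|[set v : finvect_type H | v \in U]| = (#|F| ^ \dim U)%N.
Proof.
case: H U => T c U; rewrite cardsE.
exact: (@card_vspace F (finvect_type (Vector.Pack c)) c U).
Qed.

Section Counting.

Variables (F : finFieldType) (H : vectType F).
Implicit Types (U V W x y z : {vspace H}).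

Local Notation q := #|F|.

Definition qint (n : nat) : nat := (\sum_(i < n) q ^ i)%N.

Lemma qint0 : qint 0 = 0%N. Proof. exact: big_ord0. Qed.

Lemma qintS n : qint n.+1 = (qint n + q ^ n)%N.
Proof. exact: big_ord_recr. Qed.

Lemma qint1 : qint 1 = 1%N.
Proof. by rewrite qintS qint0. Qed.

Lemma qintSl n : qint n.+1 = (q * qint n + 1)%N.
Proof.
elim: n => [|n IH]; first by rewrite qint1 qint0 muln0.
by rewrite qintS {1}IH [in RHS]qintS mulnDr -expnS addnAC.
Qed.

Lemma qint2 : qint 2 = q.+1.
Proof. by rewrite qintS qint1 expn1 add1n. Qed.

Lemma qint_gt0 n : (0 < qint n.+1)%N.
Proof. by rewrite qintSl addn1. Qed.

Lemma muln_qint n : (q.-1 * qint n = q ^ n - 1)%N.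
Proof. by rewrite -predn_exp subn1. Qed.

Lemma card_vspace_setD U W : (U <= W)%VS ->
  #|[set v : finvect_type H | v \in W & v \notin U]|
  = (q ^ \dim W - q ^ \dim U)%N.
Proof.
move=> UW; rewrite -!card_vspace_set.
rewrite -(setIidPr (_ : [set v : finvect_type H | v \in U] \subset
                        [set v : finvect_type H | v \in W])); last first.
  by apply/subsetP => v; rewrite !inE; apply/subvP.
rewrite -cardsD; apply: eq_card => v; by rewrite !inE andbC.
Qed.

Lemma memv_addv_line U (v : H) : v \in (U + <[v]>)%VS.
Proof. by rewrite memvE addvSr. Qed.

Lemma dim_addv_line U (v : H) : v \notin U -> \dim (U + <[v]>)%VS = (\dim U).+1.
Proof.
move=> vU; rewrite dimv_disjoint_sum ?dim_vline.
  by case: eqP vU => [->|]; rewrite ?mem0v ?addn1.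
apply/eqP; rewrite -subv0; apply/subvP => w; rewrite memv_cap => /andP[wU].
case/vlineP => k kE; move: wU; rewrite kE memv0.
have [->|k0] := eqVneq k 0; first by rewrite scale0r eqxx.
by rewrite rpredZeq (negPf k0) (negPf vU).
Qed.

Lemma addv_line_eq U z (v : H) :
  (U <= z)%VS -> \dim z = (\dim U).+1 -> v \notin U ->
  ((U + <[v]>)%VS == z) = (v \in z).
Proof.
move=> Uz dz vU; apply/eqP/idP => [<-|vz]; first exact: memv_addv_line.
by apply/eqP; rewrite eqEdim subv_add Uz -memvE vz dz dim_addv_line /=.
Qed.

(** The map [v |-> U + <[v]>] sends the vectors of [W] outside [U] to these subspaces, and the fibre
    over each of them, its vectors outside [U], has [(q - 1) q^(dim U)] elements. *)
Lemma card_up U W : (U <= W)%VS ->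
  #|[set z : {vspace H} |
      [&& (U <= z)%VS, (z <= W)%VS & \dim z == (\dim U).+1]]|
  = qint (\dim W - \dim U).
Proof.
move=> UW; set Z := [set z | _].
have q1 : (0 < q.-1)%N by case: #|_| (finNzRing_gt1 F) => [|[]].
have q0 : (0 < q)%N by apply: ltnW; apply: finNzRing_gt1.
have e (U' : {vspace H}) d : \dim U' = (\dim U + d)%N ->
    (q ^ \dim U' - q ^ \dim U = q.-1 * qint d * q ^ \dim U)%N.
  by move=> ->; rewrite expnD muln_qint mulnBl mul1n mulnC.
have := card_vspace_setD UW.
rewrite -sum1_card (partition_big (fun v : finvect_type H =>
  (U + <[v : H]>)%VS) (mem Z)) /=.
  rewrite (eq_bigr (fun=> q.-1 * q ^ \dim U)%N) => [|z]; last first.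
    rewrite inE => /and3P[Uz zW /eqP dz].
    transitivity (q ^ \dim z - q ^ \dim U)%N; last first.
      by rewrite (e z 1%N) ?addn1 // qint1 muln1.
    rewrite sum1_card -card_vspace_setD //.
    apply: eq_card => v; rewrite !inE unfold_in /= !inE.
    have [vU|vU] /= := boolP (v \in U); first by rewrite !andbF.
    rewrite !andbT (addv_line_eq Uz dz vU) andbC.
    by apply/andP/idP => [[]|vz] //; rewrite vz (subvP zW).
  rewrite sum_nat_const (e W (\dim W - \dim U)%N) ?subnKC ?dimvS //.
  rewrite [(q.-1 * qint _)%N]mulnC -mulnA => /eqP.
  by rewrite eqn_pmul2r ?muln_gt0 ?q1 ?expn_gt0 ?q0 // => /eqP.
move=> v; rewrite !inE => /andP[vW vU].
by rewrite addvSl subv_add UW -memvE vW dim_addv_line /=.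
Qed.

(* Double count the pairs (a, b) with a a hyperplane of W, b <= a and b
   covering U. *)
Lemma card_down U W : (U <= W)%VS ->
  #|[set z : {vspace H} |
      [&& (U <= z)%VS, (z <= W)%VS & \dim W == (\dim z).+1]]|
  = qint (\dim W - \dim U).
Proof.
move: {-2}(\dim W - \dim U)%N (erefl (\dim W - \dim U)%N) => n.
elim: n U => [|n IH] U dn UW.
  rewrite qint0; apply: eq_card0 => z; rewrite !inE; apply/negP.
  by case/and3P=> /dimvS Uz _ /eqP dW; move: (dimvS UW) dn; lia.
(* The case [n = 0] is separate because the double count is divided by [qint n]. *)
have [n0|n0] := posnP n.
  rewrite n0 qint1; apply/eqP/cards1P; exists U; apply/setP => z; rewrite !inE.
  apply/and3P/eqP => [[Uz zW /eqP dz]|->]; last by split=> //; lia.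
  by apply/esym/eqP; rewrite eqEdim Uz /=; lia.
have := erefl (
  \sum_(a : {vspace H} | [&& (U <= a)%VS, (a <= W)%VS & \dim W == (\dim a).+1])
  \sum_(b : {vspace H} |
    [&& (U <= b)%VS, (b <= a)%VS & \dim b == (\dim U).+1]) 1)%N.
rewrite [in RHS](exchange_big_dep (fun b : {vspace H} =>
  [&& (U <= b)%VS, (b <= W)%VS & \dim b == (\dim U).+1])) /=; last first.
  by move=> a b /and3P[Ua aW _] /and3P[-> ba ->]; rewrite (subv_trans ba aW).
rewrite (eq_bigr (fun=> qint n)) => [|a /and3P[Ua aW /eqP da]]; last first.
  by rewrite sum1dep_card card_up //; congr qint; lia.
rewrite [RHS](eq_bigr (fun=> qint n)) => [|b /and3P[Ub bW /eqP db]]; last first.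
  rewrite sum1dep_card -(IH b) //; last by lia.
  apply: eq_card => a; rewrite !inE Ub db eqxx andbT /=.
  have [ba|] := boolP (b <= a)%VS; last by rewrite andbF.
  by rewrite (subv_trans Ub ba) andbT.
have sum_qint (P : pred {vspace H}) :
  (\sum_(z | P z) qint n = #|[set z | P z]| * qint n)%N.
  by rewrite -sum_nat_const; apply: eq_bigl => z; rewrite inE.
rewrite !sum_qint => /eqP.
rewrite eqn_pmul2r; last by case: (n) n0 => // m _; apply: qint_gt0.
by move/eqP=> ->; rewrite card_up // dn.
Qed.

End Counting.

(* The projection val, protected from unfolding by simplification. *)
Definition sp (F : finFieldType) (H : vectType F) (h : {vspace H})
  (x : att_space h) : {vspace H} := val x.
Arguments sp : simpl never.

(** * Counting paths in the poset *)

Section PathCounting.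

Variables (F : finFieldType) (H : vectType F) (h : {vspace H}).
Implicit Types (U V W : {vspace H}) (x y z a b c : att_space h).

Local Notation q := #|F|.
Local Notation qint := (qint F).

Lemma capv0_sub U W : (U <= W)%VS -> (W :&: h == 0)%VS -> (U :&: h == 0)%VS.
Proof. by rewrite -!subv0 => UW; apply: subv_trans; rewrite capvS. Qed.

(** A nonzero [p] in [W :&: h] lies outside [U], so [W = U + <[p]>] is inside [U + h]. Conversely,
    if [W <= U + h], the modular law gives [W = U + W :&: h], which is strictly larger than [U] only
    when [W] meets [h]. *)
Lemma cover_capv0 U W :
  (U :&: h == 0)%VS -> (U <= W)%VS -> \dim W = (\dim U).+1 ->
  (W :&: h == 0)%VS = ~~ (W <= U + h)%VS.
Proof.
move=> /eqP Uh UW dW; apply/idP/idP.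
  move=> /eqP Wh; apply/negP => /capv_idPr;
    rewrite -(vspace_modl _ UW) capvC Wh addv0.
  by move=> e; move: dW; rewrite e; lia.
apply: contraR; rewrite -subv0 => /subvPn[p];
  rewrite memv_cap memv0 => /andP[pW ph] p0.
have pU : p \notin U.
  by apply: contra p0 => pU; rewrite -memv0 -Uh memv_cap pU.
have /eqP <- : (U + <[p]>)%VS == W by rewrite addv_line_eq.
by rewrite addvS // -memvE.
Qed.

(** Among all covers of [U] inside [W], those that meet [h] are the ones inside [U + W :&: h], by
    [cover_capv0] and the modular law. This sum is direct, so [card_up] counts them as
    [qint (\dim (W :&: h))]. *)
Lemma card_up_capv0 U W : (U :&: h == 0)%VS -> (U <= W)%VS ->
  (#|[set Z : {vspace H} | [&& (Z :&: h == 0)%VS, (U <= Z)%VS, (Z <= W)%VS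
      & \dim Z == (\dim U).+1]]| + qint (\dim (W :&: h)))%N
  = qint (\dim W - \dim U).
Proof.
move=> Uh UW; rewrite -(card_up UW).
have -> : \dim (W :&: h) = (\dim (U + W :&: h)%VS - \dim U)%N.
  rewrite dimv_disjoint_sum ?addKn //; apply/eqP.
  by rewrite -subv0 -(eqP Uh) capvS // capvSr.
rewrite -card_up ?addvSl // -(cardsID [set Z : {vspace H} | (Z :&: h == 0)%VS]
  [set Z : {vspace H} | [&& (U <= Z)%VS, (Z <= W)%VS & _]]).
congr (_ + _)%N; apply: eq_card => Z; rewrite !inE; first by rewrite andbC.
have [UZ|] /= := boolP (U <= Z)%VS; last by rewrite andbF.
have [/eqP dZ|] := boolP (\dim Z == _); last by rewrite !andbF.
rewrite !andbT (cover_capv0 Uh UZ dZ) negbK capvC (vspace_modl _ UW) subv_cap.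
by rewrite andbC.
Qed.

Lemma sum_att (P : pred {vspace H}) :
  (\sum_(z : att_space h) P (sp z))%N
  = #|[set Z : {vspace H} | (Z :&: h == 0)%VS && P Z]|.
Proof.
rewrite -sum1dep_card big_mkcondr /=.
rewrite (reindex_omap (val : att_space h -> {vspace H}) insub) => [|Z Zh].
  apply: eq_big => z; last by case: (P _).
  by rewrite valK eqxx andbT; case: z.
by rewrite insubT.
Qed.

Lemma sp_inj : injective (@sp F H h).
Proof. exact: val_inj. Qed.

Lemma sp_eqE x y : (x == y) = (sp x == sp y).
Proof. by rewrite (inj_eq sp_inj). Qed.

Lemma coversP z y :
  reflect ((sp y <= sp z)%VS /\ \dim (sp z) = (\dim (sp y)).+1) (covers z y).
Proof. by apply: (iffP andP) => -[zy /eqP]. Qed.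

Lemma attP z : (sp z :&: h == 0)%VS.
Proof. by case: z. Qed.

Lemma covers_sub y z : covers z y -> (sp y <= sp z)%VS.
Proof. by case/andP. Qed.

Lemma sum_between y z : \dim (sp z) = (\dim (sp y)).+2 ->
  (\sum_(a : att_space h) covers z a * covers a y = q.+1 * (sp y <= sp z)%VS)%N.
Proof.
move=> dz; under eq_bigr => a _ do rewrite mulnb.
rewrite (sum_att (fun A => ((A <= sp z)%VS && (\dim (sp z) == (\dim A).+1))
  && ((sp y <= A)%VS && (\dim A == (\dim (sp y)).+1)))).
have [yz|nyz] := boolP (sp y <= sp z)%VS; last first.
  rewrite muln0; apply: eq_card0 => A; rewrite !inE; apply/negP.
  case/and3P=> _ /andP[Az _] /andP[yA _]; case/negP: nyz; exact: subv_trans Az.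
have -> : q.+1 = qint (\dim (sp z) - \dim (sp y)).
  by rewrite -qint2 dz; congr (qint _); lia.
rewrite muln1 -card_up //.
apply: eq_card => A; rewrite !inE dz; apply/idP/idP.
  by case/and3P=> _ /andP[-> _] /andP[-> ->].
case/and3P=> -> Az /eqP dA; rewrite Az dA !eqxx (capv0_sub Az) //; exact: attP.
Qed.

Lemma sum_up_covers (N M : nat) z :
  \dim (fullv : {vspace H}) = (N + M)%N -> \dim h = M ->
  (\sum_(c : att_space h) covers c z + qint M = qint (N + M - \dim (sp z)))%N.
Proof.
move=> dH dh.
rewrite (sum_att (fun Z => (sp z <= Z)%VS && (\dim Z == (\dim (sp z)).+1))).
rewrite -dH -card_up_capv0 ?subvf ?attP // capvC capvf dh; congr (_ + _)%N.
by apply: eq_card => Z; rewrite !inE subvf.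
Qed.

Lemma sum_down_covers_sub U z : (U <= sp z)%VS ->
  (\sum_(a : att_space h) covers z a * (U <= sp a)%VS
   = qint (\dim (sp z) - \dim U))%N.
Proof.
move=> Uz; under eq_bigr => a _ do rewrite mulnb.
rewrite (sum_att (fun A => ((A <= sp z)%VS && (\dim (sp z) == (\dim A).+1))
  && (U <= A)%VS)) -card_down //.
apply: eq_card => A; rewrite !inE; apply/idP/idP.
  by case/and3P=> _ /andP[-> ->] ->.
by case/and3P=> -> Az ->; rewrite Az (capv0_sub Az) //; exact: attP.
Qed.

Lemma sum_down_covers z :
  (\sum_(a : att_space h) covers z a = qint (\dim (sp z)))%N.
Proof.
have := sum_down_covers_sub (sub0v (sp z)); rewrite dimv0 subn0 => <-.
by apply: eq_bigr => a _; rewrite sub0v muln1.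
Qed.

(** For [b = y] every subspace covered by [y] is a possible [a]. For any other [b] the dimension
    forces [y :&: b = x], so that [a = x] is the only choice. Since [x] lies in [y], the containment
    conditions on the right are automatic, and both sides become expressions in [qint]. *)
Lemma path_count_sub (N M : nat) x y :
  \dim (fullv : {vspace H}) = (N + M)%N -> \dim h = M ->
  covers y x ->
  (\sum_(b : att_space h) covers b x *
     \sum_(a : att_space h) covers y a * covers b a
   = q * (\sum_(b : att_space h) covers x b * (sp b <= sp y)%VS)
     + \sum_(c : att_space h) covers c y * (sp x <= sp c)%VS
     + q ^ (N + M - (\dim (sp x)).+1))%N.
Proof.
move=> dH dh cyx; have /coversP[xy dy] := cyx.
have leN : (\dim (sp y) <= N + M)%N by rewrite -dH dimvS ?subvf.
have -> : (\sum_(b : att_space h) covers x b * (sp b <= sp y)%VS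
    = qint (\dim (sp x)))%N.
  rewrite -sum_down_covers; apply: eq_bigr => b _.
  by have [/covers_sub bx|//] := boolP (covers x b); rewrite (subv_trans bx xy).
have -> : (\sum_(c : att_space h) covers c y * (sp x <= sp c)%VS
     = \sum_(c : att_space h) covers c y)%N.
  apply: eq_bigr => c _; have [/covers_sub yc|//] := boolP (covers c y).
  by rewrite (subv_trans xy yc).
rewrite (bigD1 y) //= cyx mul1n.
have -> : (\sum_(a : att_space h) covers y a * covers y a
    = qint (\dim (sp x)).+1)%N.
  by rewrite -dy -sum_down_covers; apply: eq_bigr => a _; rewrite mulnb andbb.
rewrite (eq_bigr (fun b => covers b x : nat)) => [|b bny]; last first.
  have [cbx|] := boolP (covers b x); last by rewrite mul0n.
  have /coversP[xb db] := cbx.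
  rewrite (bigD1 x) //= cyx cbx big1 // => a anx; rewrite mulnb; apply/eqP.
  rewrite eqb0; apply: contra anx => /andP[/coversP[ay da] /coversP[ab _]].
  have ybx : (sp y :&: sp b)%VS = sp x.
    apply/esym/eqP; rewrite eqEdim subv_cap xy xb /=.
    rewrite leqNgt; apply: contra bny => lt.
    rewrite sp_eqE eq_sym eqEdim db -dy leqnn andbT.
    apply/capv_idPl/eqP; rewrite eqEdim capvSl; lia.
  have ax : (sp a <= sp x)%VS by rewrite -ybx subv_cap ay.
  by rewrite sp_eqE eqEdim ax /= -ltnS -dy da.
have := sum_up_covers x dH dh; have := sum_up_covers y dH dh.
have -> : (\sum_(c : att_space h) covers c x
    = 1 + \sum_(c | c != y) covers c x)%N.
  by rewrite (bigD1 y) //= cyx.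
have -> : (N + M - \dim (sp x))%N = (N + M - (\dim (sp x)).+1).+1 by lia.
rewrite (qintS F (N + M - (\dim (sp x)).+1)) (qintSl F (\dim (sp x))) dy.
set r := (\sum_(c | _) covers c x)%N; set c := (\sum_c covers c y)%N.
by move: (_ ^ _)%N (qint M) (qint (_ - _)) (_ * _)%N => *; lia.
Qed.

(* Here a pair (a, b) is determined by b, and b ranges over the covers of x
   inside x + y. *)
Lemma path_count_nsub (N M : nat) x y :
  \dim (sp y) = (\dim (sp x)).+1 -> ~~ (sp x <= sp y)%VS ->
  (\sum_(b : att_space h) covers b x *
     \sum_(a : att_space h) covers y a * covers b a
   = q * (\sum_(b : att_space h) covers x b * (sp b <= sp y)%VS)
     + \sum_(c : att_space h) covers c y * (sp x <= sp c)%VS)%N.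
Proof.
move=> dy nxy.
have dcap := dimv_sum_cap (sp x) (sp y).
have lt_cap : (\dim (sp x :&: sp y) < \dim (sp x))%N.
  rewrite ltnNge; apply: contra nxy => le.
  by apply/capv_idPl/eqP; rewrite eqEdim capvSl.
(* [d] says that [x :&: y] is a hyperplane of [x], equivalently that [x + y] has dimension
   [dim y + 1]. Without it all three sums vanish. *)
pose d : bool := (\dim (sp x :&: sp y)).+1 == \dim (sp x).
have -> : (\sum_(b : att_space h) covers x b * (sp b <= sp y)%VS = d)%N.
  under eq_bigr => b _ do rewrite mulnb.
  rewrite (sum_att (fun B => ((B <= sp x)%VS && (\dim (sp x) == (\dim B).+1))
    && (B <= sp y)%VS)).
  have [dE|] := boolP d; last first.
    move=> dN; apply: eq_card0 => B; rewrite !inE; apply: contraNF dN.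
    case/and3P=> _ /andP[Bx /eqP dB] By; rewrite /d dB eqSS eqn_leq.
    rewrite [X in _ && X]dimvS ?subv_cap ?Bx // andbT; lia.
  apply/eqP/cards1P; exists (sp x :&: sp y)%VS; apply/setP => B.
  rewrite !inE; apply/idP/eqP => [|->]; last first.
    by rewrite (capv0_sub (capvSl _ _)) ?attP // capvSl capvSr andbT eq_sym.
  case/and3P=> _ /andP[Bx /eqP dB] By; apply/eqP;
    rewrite eqEdim subv_cap Bx By /=.
  lia.
have -> : (\sum_(c : att_space h) covers c y * (sp x <= sp c)%VS
    = d && ((sp x + sp y) :&: h == 0)%VS)%N.
  under eq_bigr => c _ do rewrite mulnb.
  rewrite (sum_att (fun Z => ((sp y <= Z)%VS && (\dim Z == (\dim (sp y)).+1))
    && (sp x <= Z)%VS)).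
  have [|dN] := boolP (d && _).
    case/andP=> /eqP dE hE; apply/eqP/cards1P; exists (sp x + sp y)%VS;
      apply/setP => Z.
    rewrite !inE; apply/idP/eqP => [|->]; last first.
      by rewrite addvSl addvSr hE /= andbT; apply/eqP; lia.
    case/and3P=> _ /andP[yZ /eqP dZ] xZ; apply/esym/eqP.
    rewrite eqEdim subv_add xZ yZ /=; lia.
  apply: eq_card0 => Z; rewrite !inE; apply: contraNF dN.
  case/and3P=> Zh /andP[yZ /eqP dZ] xZ.
  have le : (sp x + sp y <= Z)%VS by rewrite subv_add xZ.
  rewrite (capv0_sub le Zh) andbT /d; have := dimvS le; lia.
have b_y b : covers b x -> (\dim (sp y :&: sp b) <= \dim (sp x))%N.
  case/coversP=> xb db; rewrite leqNgt; apply: contra nxy => lt.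
  apply: (subv_trans xb); apply/capv_idPr/eqP; rewrite eqEdim capvSr /=.
  by rewrite db.
have b_sum b : covers b x ->
    (\dim (sp y :&: sp b) == \dim (sp x))%N = d && (sp b <= sp x + sp y)%VS.
  move=> cb; have /coversP[xb db] := cb; have := b_y b cb.
  have := dimv_sum_cap (sp y) (sp b).
  have le : (sp x + sp y <= sp y + sp b)%VS by rewrite addvC addvS.
  have := dimvS le => le1 e1 le2;
  apply/eqP/andP => [e2|[/eqP dE bxy]].
    have dE : d by apply/eqP; lia.
    split=> //; have /eqP -> : (sp x + sp y == sp y + sp b)%VS.
      by rewrite eqEdim le /=; lia.
    exact: addvSr.
  have : (sp y + sp b <= sp x + sp y)%VS by rewrite subv_add addvSr.
  by move/dimvS; lia.
rewrite (eq_bigr (fun b =>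
  covers b x && (d && (sp b <= sp x + sp y)%VS) : nat)) => [|b _]; last first.
  have [cb|//] := boolP (covers b x); rewrite mul1n /= -(b_sum b cb).
  under eq_bigr => a _ do rewrite mulnb.
  rewrite (sum_att (fun A =>
    ((A <= sp y)%VS && (\dim (sp y) == (\dim A).+1)) && ((A <= sp b)%VS &&
    (\dim (sp b) == (\dim A).+1)))).
  have [/eqP dE|dN] := boolP (\dim _ == \dim (sp x)).
    apply/eqP/cards1P; exists (sp y :&: sp b)%VS; apply/setP => A; rewrite !inE.
    have /coversP[_ db] := cb.
    apply/idP/eqP => [|->]; last first.
      by rewrite capvSl capvSr (capv0_sub (capvSl _ _)) ?attP // dE dy db !eqxx.
    case/and3P=> _ /andP[Ay /eqP dA] /andP[Ab _]; apply/eqP.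
    by rewrite eqEdim subv_cap Ay Ab /=; lia.
  apply: eq_card0 => A; rewrite !inE; apply: contraNF dN.
  case/and3P=> _ /andP[Ay /eqP dA] /andP[Ab _].
  rewrite eqn_leq b_y //=; apply: leq_trans (dimvS (_ : (A <= _)%VS));
    first by lia.
  by rewrite subv_cap Ay.
have [dE|_] /= := boolP d; last first.
  by rewrite muln0; apply: big1 => b _; rewrite andbF.
rewrite (sum_att (fun B =>
  ((sp x <= B)%VS && (\dim B == (\dim (sp x)).+1)) && (B <= sp x + sp y)%VS)).
have := card_up_capv0 (attP x) (addvSl (sp x) (sp y)).
have -> : (\dim (sp x + sp y) - \dim (sp x) = 2)%N.
  by lia.
rewrite qint2 muln1.
rewrite (eq_card (B := [set B | (B :&: h == 0)%VS &&
  (((sp x <= B)%VS && (\dim B == (\dim (sp x)).+1))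
   && (B <= sp x + sp y)%VS)])); last first.
  move=> B; rewrite !inE.
  by apply/and4P/andP => [[-> -> -> ->]|[-> /andP[/andP[-> ->] ->]]].
(* As [y] is a hyperplane of [x + y] that avoids [h], the space [x + y] meets [h] in at most a line.
   Hence [q + 1] or [q] covers of [x] inside [x + y] avoid [h], according to whether [x + y] itself
   does. *)
have : (\dim ((sp x + sp y) :&: h) <= 1)%N.
  have /dimv_disjoint_sum e : (sp y :&: ((sp x + sp y) :&: h) = 0)%VS.
    by apply/eqP; rewrite -subv0 -(eqP (attP y)) capvS // capvSr.
  have : (sp y + (sp x + sp y) :&: h <= sp x + sp y)%VS.
    by rewrite subv_add addvSr capvSl.
  by move/dimvS; rewrite e; lia.
have -> : ((sp x + sp y) :&: h == 0)%VS = (\dim ((sp x + sp y) :&: h) == 0)%N.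
  by rewrite dimv_eq0.
by case: (\dim _) => [|[|//]] _; rewrite ?qint0 ?qint1 /=; lia.
Qed.

End PathCounting.

(** * Matrices and eigenspaces *)

Section CubicRelation.

Variables (C : fieldType) (n : nat) (q c : C) (U D K : 'M[C]_n).

Hypothesis q0 : q != 0.
Hypothesis UK : U *m K = q *: (K *m U).
Hypothesis DK : D *m K = q^-1 *: (K *m D).
Hypothesis relU :
  q ^+ 3 *: (U *m U *m D) - (q * (q + 1)) *: (U *m D *m U) + D *m U *m U
  = - c *: U.
Hypothesis relD :
  q ^+ 3 *: (U *m D *m D) - (q * (q + 1)) *: (D *m U *m D) + D *m D *m U
  = - c *: D.

Let A := U + D.

(** Moving [K] to the left turns each [A] that it passes into [T = q U + q^-1 D]. Every term is then
    [K] times a word in [T] and [A], and what remains is an identity between words of length three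
    in [U] and [D], modulo [relU] and [relD]. *)
Lemma cubic_relation :
  A *m A *m A *m K - (q + q^-1 + 1) *: (A *m A *m K *m A)
    + (q + q^-1 + 1) *: (A *m K *m A *m A) - K *m A *m A *m A
  = (c * (q + 1) / q ^+ 2) *: (A *m K - K *m A).
Proof.
pose T := q *: U + q^-1 *: D.
have AK : A *m K = K *m T.
  by rewrite mulmxDl UK DK mulmxDr -!scalemxAr.
have e1 : A *m A *m A *m K = K *m (T *m T *m T).
  by rewrite -!mulmxA AK !mulmxA -(mulmxA A A) AK !mulmxA AK.
have e2 : A *m A *m K *m A = K *m (T *m T *m A).
  by rewrite -(mulmxA A A) AK !mulmxA AK.
have e3 : A *m K *m A *m A = K *m (T *m A *m A) by rewrite AK !mulmxA.
rewrite e1 e2 e3 AK -!mulmxA !scalemxAr -!mulmxBr -mulmxDr -mulmxBr !scalemxAr.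
congr (_ *m _); rewrite -!scalemxAr /T /A.
rewrite !(mulmxDl, mulmxDr, mulmxN, =^~ scalemxAl, =^~ scalemxAr).
apply/matrixP => i j.
move/matrixP/(_ i j): relU; move/matrixP/(_ i j): relD; rewrite -!mulmxA.
move: (U *m (U *m U)) (U *m (U *m D)) (U *m (D *m U)) (U *m (D *m D))
  (D *m (U *m U)) (D *m (U *m D)) (D *m (D *m U)) (D *m (D *m D)).
move=> uuu uud udu udd duu dud ddu ddd; rewrite !mxE => rD rU.
(* [relU] eliminates the word [DUU] and [relD] the word [DDU]; the six other words are treated as
   independent. *)
have -> : duu i j = - c * U i j - q ^+ 3 * uud i j + q * (q + 1) * udu i j.
  by rewrite -rU; ring.
have -> : ddu i j = - c * D i j - q ^+ 3 * udd i j + q * (q + 1) * dud i j.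
  by rewrite -rD; ring.
by field.
Qed.

End CubicRelation.

Lemma trmxD (K : nzRingType) m n (X Y : 'M[K]_(m, n)) : (X + Y)^T = X^T + Y^T.
Proof. exact: raddfD. Qed.

Lemma trmxB (K : nzRingType) m n (X Y : 'M[K]_(m, n)) : (X - Y)^T = X^T - Y^T.
Proof. exact: raddfB. Qed.

Lemma trmxZ (K : comNzRingType) m n k (X : 'M[K]_(m, n)) :
  (k *: X)^T = k *: X^T.
Proof. exact: linearZ. Qed.

Lemma similar_cubic (K : fieldType) n (A B L W : 'M[K]_n) (k l : K) :
  W \in unitmx -> W *m A = B *m W -> W *m L = L *m W ->
  B *m B *m B *m L - k *: (B *m B *m L *m B) + k *: (B *m L *m B *m B)
    - L *m B *m B *m B = l *: (B *m L - L *m B) ->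
  A *m A *m A *m L - k *: (A *m A *m L *m A) + k *: (A *m L *m A *m A)
    - L *m A *m A *m A = l *: (A *m L - L *m A).
Proof.
move=> uW WA WL eB; apply: (can_inj (mulKmx uW)).
have WAx X : W *m (A *m X) = B *m (W *m X) by rewrite mulmxA WA mulmxA.
have WLx X : W *m (L *m X) = L *m (W *m X) by rewrite mulmxA WL mulmxA.
rewrite -!mulmxA !(mulmxDr, mulmxN, =^~ scalemxAr) !(WAx, WLx) !(WA, WL).
move/(congr1 (mulmx^~ W)): eB => /=.
by rewrite !(mulmxDl, mulNmx, =^~ scalemxAl) -!mulmxA.
Qed.

Lemma similar_hermitian_diagonalizable (K : numClosedFieldType) n
    (A B W : 'M[K]_n) :
  B \is hermsymmx -> W \in unitmx -> W *m A = B *m W ->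
  exists P d, P \in unitmx /\ A = invmx P *m diag_mx d *m P.
Proof.
move=> hB uW WA; have /orthomx_spectralP := hermitian_normalmx hB.
move: (spectralmx B) (spectral_diag B) (spectral_unit B) => P d uP eB.
have uPW : P *m W \in unitmx by rewrite unitmx_mul uP uW.
exists (P *m W), d; split=> //; rewrite -mulmxA; apply: (canRL (mulKmx uPW)).
by rewrite -mulmxA WA eB !mulmxA mulmxV // mul1mx.
Qed.

Lemma divf_exprS (K : fieldType) (r u : K) d :
  r != 0 -> u * r ^- d = r * (r ^- d.+1 * u).
Proof. by move=> r0; rewrite exprS invfM mulrA mulVKf // mulrC. Qed.

(** Newton interpolation: the new node [u n] is accommodated by adding a multiple of [w], which
    vanishes at all earlier nodes and not at [u n]. *)
Lemma poly_interpolation (K : fieldType) (u f : nat -> K) n :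
  {in gtn n &, injective u} ->
  exists2 p : {poly K}, (size p <= n)%N & forall i, (i < n)%N -> p.[u i] = f i.
Proof.
elim: n => [|n IH] uI; first by exists 0; rewrite ?size_poly0.
have [|p sp pE] := IH; first by move=> i j ? ?; apply: uI; apply: ltnW.
pose w : {poly K} := \prod_(j < n) ('X - (u j)%:P).
have w0 : w.[u n] != 0.
  rewrite horner_prod; apply/prodf_neq0 => j _; rewrite hornerXsubC subr_eq0.
  apply/eqP => /uI; rewrite !unfold_in /= =>
    /(_ (ltnSn n) (leqW (ltn_ord j))) nj.
  by have := ltn_ord j; rewrite -nj ltnn.
exists (p + ((f n - p.[u n]) / w.[u n]) *: w) => [|i].
  apply: leq_trans (size_polyD _ _) _; rewrite geq_max (leq_trans sp) //=.
  by apply: leq_trans (size_scale_leq _ _) _;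
    rewrite size_prod_XsubC /index_enum -enumT size_enum_ord.
rewrite ltnS leq_eqVlt hornerD hornerZ => /predU1P[->|lt_in];
  first by rewrite divfK // addrC subrK.
rewrite pE // [w.[u i]]horner_prod (bigD1 (Ordinal lt_in)) //= hornerXsubC
  subrr.
by rewrite mul0r mulr0 addr0.
Qed.

Section LinearAlgebraFacts.

Variables (C : fieldType) (n : nat).
Implicit Types (A B : 'M[C]_n) (v : 'cV[C]_n).

Lemma mxactE A v : mxact A v = A *m v.
Proof. by rewrite lfunE. Qed.

Lemma mem_mx_eigenspace A a v : (v \in mx_eigenspace A a) = (A *m v == a *: v).
Proof.
rewrite /mx_eigenspace /passmx.leigenspace memv_ker.
by rewrite !lfun_simp /= subr_eq0.
Qed.

Lemma leigenvalueP A a :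
  passmx.leigenvalue (mxact A) a <->
  exists2 v : 'cV[C]_n, v != 0 & A *m v = a *: v.
Proof.
split=> [|[v v0 Av]].
  rewrite /passmx.leigenvalue -vpick0 => v0;
    exists (vpick (mx_eigenspace A a)) => //.
  by apply/eqP; rewrite -mem_mx_eigenspace memv_pick.
apply/eqP => E0; case/negP: v0; rewrite -memv0 -E0.
by rewrite -/(mx_eigenspace A a) mem_mx_eigenspace Av.
Qed.

Lemma mxact_endo_mx (f : 'End('cV[C]_n)) : mxact (endo_mx f) = f.
Proof.
apply/lfunP => v; rewrite mxactE [in RHS](matrix_sum_delta v) linear_sum.
apply/colP => i; rewrite mxE summxE; apply: eq_bigr => j _.
by rewrite big_ord1 linearZ !mxE mulrC.
Qed.

Lemma mxim_daddv_pi (U W : {vspace 'cV[C]_n}) :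
  (U :&: W)%VS = 0%VS -> mxim (endo_mx (daddv_pi U W)) = U.
Proof.
move=> UW; rewrite /mxim mxact_endo_mx; apply/eqP; rewrite eqEsubv;
  apply/andP; split.
  by apply/subvP => _ /memv_imgP[v _ ->]; apply: memv_pi.
by apply/subvP => v Uv; rewrite -(daddv_pi_id UW Uv) memv_img ?memvf.
Qed.

End LinearAlgebraFacts.

(** This is the scalar form of the cubic relation: [th t] is the eigenvalue of a vector [v], while
    [y] is a coordinate of [K v] in an eigenbasis and [z] the eigenvalue of that coordinate. *)
Lemma cubic_factor (K : fieldType) (q t r c z y : K)
    (th := fun u : K => (r / u - u) * c) : t != 0 -> q != 0 ->
  z * (z * (z * y)) - (q + q^-1 + 1) * (th t * (z * (z * y)))
    + (q + q^-1 + 1) * (th t * (th t * (z * y))) - th t * (th t * (th t * y))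
  = c ^+ 2 * r * (q - q^-1) ^+ 2 * (z * y - th t * y) ->
  (z - th (t / q)) * (z - th t) * (z - th (t * q)) * y = 0.
Proof.
move=> t0 q0 /eqP; rewrite -subr_eq0 => /eqP <-; rewrite /th; field.
by rewrite t0 q0.
Qed.

(** * Chains of eigenspaces *)

Section SpectralChain.

Variables (C : numClosedFieldType) (n : nat) (A K P S : 'M[C]_n) (d : 'rV[C]_n).
Variables (s c : C) (N : nat).

Local Notation q := (s ^+ 2).

(** The parameter [t] ranges over all nonzero scalars, so that a step along a chain is
    multiplication or division of [t] by [q] before [t] is known to be a power of [s]. *)
Definition chain_th (t : C) : C := (s ^+ (2 * N) / t - t) * c.

Local Notation th := chain_th.

Hypotheses (s1 : 1 < s) (c0 : c != 0).
Hypotheses (uP : P \in unitmx) (AE : A = invmx P *m diag_mx d *m P).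
Hypothesis cubic :
  A *m A *m A *m K - (q + q^-1 + 1) *: (A *m A *m K *m A)
    + (q + q^-1 + 1) *: (A *m K *m A *m A) - K *m A *m A *m A
  = (c ^+ 2 * s ^+ (2 * N) * (q - q^-1) ^+ 2) *: (A *m K - K *m A).
(* This holds for every polynomial S of degree at most N in K. *)
Hypothesis filtS : forall (W : nat -> 'cV[C]_n -> Prop) v,
  (forall m u w, W m u -> W m w -> W m (u + w)) ->
  (forall m (r : C) u, W m u -> W m (r *: u)) ->
  (forall m u, W m u -> W m.+1 (K *m u)) ->
  (forall m u, W m u -> W m.+1 u) ->
  W 0 v -> W N (S *m v).
Hypotheses (SS : S *m S = 1%:M) (SA : S *m A = - (A *m S)).

Implicit Types (Q : C -> Prop) (v w : 'cV[C]_n) (a b t : C).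

Let s_gt0 : 0 < s. Proof. exact: lt_trans ltr01 s1. Qed.
Let s0 : s != 0. Proof. exact: lt0r_neq0. Qed.
Let sX0 k : s ^+ k != 0. Proof. by rewrite expf_neq0. Qed.
Let sX_gt0 k : 0 < s ^+ k. Proof. by rewrite exprn_gt0. Qed.

Let sX_inj : injective (GRing.exp s).
Proof. by apply: ieexprIn; rewrite ?gt_eqF. Qed.

(* v is a sum of eigenvectors of A whose eigenvalues satisfy Q. *)
Definition spec_in Q v := forall j, (P *m v) j 0 != 0 -> Q (d 0 j).

Definition eigval a := exists2 w : 'cV[C]_n, w != 0 & A *m w = a *: w.

Lemma spec_in0 Q : spec_in Q 0.
Proof. by move=> j; rewrite mulmx0 mxE eqxx. Qed.

Lemma spec_inD Q v w : spec_in Q v -> spec_in Q w -> spec_in Q (v + w).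
Proof.
move=> Qv Qw j; rewrite mulmxDr mxE => vw.
have [v0|/Qv//] := eqVneq ((P *m v) j 0) 0.
by apply: Qw; rewrite v0 add0r in vw.
Qed.

Lemma spec_inZ Q a v : spec_in Q v -> spec_in Q (a *: v).
Proof.
by move=> Qv j; rewrite -scalemxAr mxE mulf_eq0 negb_or => /andP[_ /Qv].
Qed.

Lemma spec_inW Q Q' v : (forall a, Q a -> Q' a) -> spec_in Q v -> spec_in Q' v.
Proof. by move=> QQ' Qv j /Qv /QQ'. Qed.

Lemma mulPA v j : (P *m (A *m v)) j 0 = d 0 j * (P *m v) j 0.
Proof. by rewrite AE !mulmxA mulmxV // mul1mx -mulmxA mul_diag_mx mxE. Qed.

Lemma spec_in_eigen a v : A *m v = a *: v <-> spec_in (eq^~ a) v.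
Proof.
split=> [e j v0|Qv].
  apply: (mulIf v0); by rewrite -mulPA e -scalemxAr mxE.
apply: (can_inj (mulKmx uP)); apply/colP => j;
  rewrite mulPA -scalemxAr [RHS]mxE.
by have [->|/Qv ->] := eqVneq ((P *m v) j 0) 0; rewrite ?mulr0.
Qed.

Lemma mulmx_col_invmx j : P *m col j (invmx P) = delta_mx j 0.
Proof. by rewrite colE mulmxA mulmxV // mul1mx. Qed.

Lemma eigen_col j : A *m col j (invmx P) = d 0 j *: col j (invmx P).
Proof.
apply/spec_in_eigen => i; rewrite mulmx_col_invmx mxE.
by case: (i =P j) => [->|] //=; rewrite eqxx.
Qed.

Lemma eigval_diag j : eigval (d 0 j).
Proof.
exists (col j (invmx P)); last exact: eigen_col.
apply/eqP => /(congr1 (mulmx P)); rewrite mulmx_col_invmx mulmx0.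
by move/colP/(_ j); rewrite !mxE !eqxx => /eqP; rewrite oner_eq0.
Qed.

(** The columns of [invmx P] are eigenvectors of [A], and [v] is their combination with coefficients
    [P *m v]. *)
Lemma spec_in_ind Q (W : 'cV[C]_n -> Prop) v :
  W 0 -> (forall u w, W u -> W w -> W (u + w)) ->
  (forall r u, W u -> W (r *: u)) ->
  (forall a w, eigval a -> Q a -> A *m w = a *: w -> W w) -> spec_in Q v -> W v.
Proof.
move=> W0 WD WZ WE Qv.
have -> : v = \sum_j (P *m v) j 0 *: col j (invmx P).
  rewrite -{1}(mulKmx uP v); apply/colP => i; rewrite mxE summxE.
  by apply: eq_bigr => j _; rewrite !mxE mulrC.
apply: big_ind => // j _.
have [->|/Qv Qj] := eqVneq ((P *m v) j 0) 0; first by rewrite scale0r.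
by apply: WZ; apply: WE (eigen_col j) => //; apply: eigval_diag.
Qed.

Lemma spec_in_neq0 Q v : v != 0 -> spec_in Q v -> exists2 a, eigval a & Q a.
Proof.
move=> v0 Qv; have /existsP[j vj] : [exists j, (P *m v) j 0 != 0].
  apply: contraNT v0 => /existsPn v0; rewrite -(mulKmx uP v); apply/eqP.
  have -> : P *m v = 0 by apply/colP => j; rewrite [RHS]mxE; apply/eqP/negPn/v0.
  exact: mulmx0.
by exists (d 0 j); [apply: eigval_diag | apply: Qv].
Qed.

Lemma spec_inI Q Q' v :
  spec_in Q v -> spec_in Q' v -> spec_in (fun a => Q a /\ Q' a) v.
Proof. by move=> Qv Q'v j vj; split; [apply: Qv | apply: Q'v]. Qed.

Lemma eigvalP a : reflect (eigval a) [exists j, d 0 j == a].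
Proof.
apply: (iffP existsP) => [[j /eqP <-]|[w w0 /spec_in_eigen wa]].
  exact: eigval_diag.
have /existsP[j wj] : [exists j, (P *m w) j 0 != 0].
  apply: contraNT w0 => /existsPn w0; rewrite -(mulKmx uP w).
  by have -> : P *m w = 0; [apply/colP => j; rewrite [RHS]mxE;
    apply/eqP/negPn/w0 | rewrite mulmx0].
by exists j; apply/eqP/wa.
Qed.

Lemma spec_in_eigval Q v : spec_in Q v -> spec_in (fun a => eigval a /\ Q a) v.
Proof. by move=> Qv j /Qv Qj; split=> //; apply: eigval_diag. Qed.

(** Apply the cubic relation to [v] and read one eigenbasis coordinate: each [A] to the left of [K]
    becomes [d 0 j], each [A] to its right becomes [th t], and [cubic_factor] lists the possible
    values of [d 0 j]. *)
Lemma chain_step t v : t != 0 -> A *m v = th t *: v ->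
  spec_in (fun a => [\/ a = th (t / q), a = th t | a = th (t * q)]) (K *m v).
Proof.
move=> t0 Av j; set x := (P *m (K *m v)) j 0 => x0.
have := congr1 (fun X => (P *m (X *m v)) j 0) cubic => /=.
rewrite mulmxBl mulmxDl mulmxBl -!scalemxAl mulmxBl.
rewrite mulmxBr mulmxDr mulmxBr -!scalemxAr mulmxBr.
have mxB (X Y : 'cV[C]_n) : (X - Y) j 0 = X j 0 - Y j 0 by rewrite !mxE.
have mxD (X Y : 'cV[C]_n) : (X + Y) j 0 = X j 0 + Y j 0 by rewrite !mxE.
have mxZ k (X : 'cV[C]_n) : (k *: X) j 0 = k * X j 0 by rewrite !mxE.
rewrite mxB mxD mxB !mxZ mxB -!mulmxA !(Av, =^~ scalemxAr) !mxZ !mulPA -/x.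
move/(cubic_factor t0 (sX0 2)).
move/eqP; rewrite mulf_eq0 (negPf x0) orbF !mulf_eq0 !subr_eq0 -orbA.
by case/or3P => /eqP; [constructor 1 | constructor 2 | constructor 3].
Qed.

Lemma chain_stepQ Q Q' v :
  (forall a, eigval a -> Q a -> exists2 t, t != 0 & a = th t /\
     forall b, eigval b ->
       [\/ b = th (t / q), b = th t | b = th (t * q)] -> Q' b) ->
  spec_in Q v -> spec_in Q' (K *m v).
Proof.
move=> QQ'; apply: (@spec_in_ind Q (fun v => spec_in Q' (K *m v))) =>
  [|u w|r u|a w ea Qa Aw].
- by rewrite mulmx0; apply: spec_in0.
- by rewrite mulmxDr; apply: spec_inD.
- by rewrite -scalemxAr; apply: spec_inZ.
have [t t0 [aE Qt]] := QQ' a ea Qa.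
rewrite aE in Aw; apply: spec_inW (spec_in_eigval (chain_step t0 Aw)).
by move=> b [eb]; apply: Qt.
Qed.

Lemma chain_thN t : t != 0 -> th (s ^+ (2 * N) / t) = - th t.
Proof.
move=> t0; rewrite /th /chain_th invf_div mulrCA divff //.
by rewrite mulr1 -opprB mulNr.
Qed.

Lemma chain_th_opp t : th (- t) = - th t.
Proof. by rewrite /th /chain_th invrN mulrN opprK addrC -opprB mulNr. Qed.

(** For fixed [u] this is a quadratic equation in [t], with roots [u] and [- q^N / u]. The second
    root is discarded in later uses by positivity of [t * u]. *)
Lemma chain_th_eq t u : t != 0 -> u != 0 -> th t = th u ->
  t = u \/ t * u = - s ^+ (2 * N).
Proof.
move=> t0 u0 /(mulIf c0)/eqP; rewrite -subr_eq0 => /eqP e.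
have : (t - u) * (t * u + s ^+ (2 * N)) = 0.
  rewrite -[RHS](mul0r (- t * u)) -e; field; by rewrite t0 u0.
by move/eqP; rewrite mulf_eq0 subr_eq0 addr_eq0 => /orP[] /eqP; [left|right].
Qed.

Lemma chain_th_surj a : exists2 t, t != 0 & a = th t.
Proof.
(* [t] is a root of [t^2 + b t = q^N], which is the equation [th t = a] cleared of denominators. *)
pose b := a / c; pose t := (- b + sqrtC (b ^+ 2 + 4 * s ^+ (2 * N))) / 2.
have tE : t ^+ 2 + b * t = s ^+ (2 * N).
  have := sqrtCK (b ^+ 2 + 4 * s ^+ (2 * N)); rewrite /t;
    move: (sqrtC _) => r e.
  have -> : s ^+ (2 * N) = (r ^+ 2 - b ^+ 2) / 4 by rewrite e; field.
  by field.
have t0 : t != 0.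
  by apply/eqP => t0; move/eqP: tE;
    rewrite t0 expr0n mulr0 addr0 eq_sym (negPf (sX0 _)).
exists t => //; rewrite /th /chain_th -tE /b; field; by rewrite t0 c0.
Qed.

Lemma S_neq0 v : v != 0 -> S *m v != 0.
Proof.
apply: contra => /eqP Sv; rewrite -[v]mul1mx -SS -mulmxA Sv mulmx0; exact/eqP.
Qed.

Lemma S_eigen a v : A *m v = a *: v -> A *m (S *m v) = - a *: (S *m v).
Proof.
move=> Av; rewrite mulmxA -[A *m S]opprK -SA mulNmx -mulmxA Av -scalemxAr
  scaleNr.
by [].
Qed.

Lemma eigval_chain a : eigval a -> exists2 k, (k <= 2 * N)%N & a = th (s ^+ k).
Proof.
case=> v v0 Av; have [t t0 aE] := chain_th_surj a.
(* [W m] allows the parameters [t q^e] with [-m <= e <= m]; writing [e = j - m] keeps the exponents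
   natural. Each application of [K] enlarges the range by one on both sides. *)
pose W m := spec_in (fun b =>
  exists2 j, (j <= 2 * m)%N & b = th (t * q ^+ j / q ^+ m)).
have q0 m : q ^+ m != 0 by rewrite expf_neq0.
have h1 (u r : C) j m : u * r ^+ j / r ^+ m / r = u * r ^+ j / r ^+ m.+1.
  by rewrite exprSr invfM mulrA.
have h2 (u r : C) j m :
  r != 0 -> u * r ^+ j / r ^+ m = u * r ^+ j.+1 / r ^+ m.+1.
  by move=> r0; rewrite !exprSr mulrA -mulf_div divff // mulr1.
have h3 (u r : C) j m : u * r ^+ j.+1 / r ^+ m * r = u * r ^+ j.+2 / r ^+ m.
  by rewrite [r ^+ j.+2]exprSr mulrA mulrAC.
have WS : spec_in (fun b =>
  exists2 j, (j <= 2 * N)%N & b = th (t * q ^+ j / q ^+ N)) (S *m v).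
  apply: (filtS (W := W)) => [m u w|m r u|m u|m u|].
  - exact: spec_inD.
  - exact: spec_inZ.
  - apply: chain_stepQ => b _ [j jm ->]; exists (t * q ^+ j / q ^+ m).
      by rewrite !mulf_neq0 ?invr_neq0.
    split=> // b' _ [] ->; [exists j | exists j.+1 | exists j.+2]; try lia.
    + by rewrite h1.
    + by rewrite (h2 t).
    + by rewrite (h2 t) // h3.
  - apply: spec_inW => b [j jm ->]; exists j.+1; first by lia.
    by rewrite (h2 t).
  apply: (@spec_inW (eq^~ a)); last exact/spec_in_eigen.
  by move=> b ->; exists 0; rewrite ?expr0 ?mulr1 ?divr1.
have SQ := (spec_in_eigen (- a) (S *m v)).1 (S_eigen Av).
have [b _ [bE [j jN]]] := spec_in_neq0 (S_neq0 v0) (spec_inI SQ WS).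
rewrite bE aE -chain_thN // => /chain_th_eq[||e|e].
- by rewrite mulf_neq0 ?invr_neq0.
- by rewrite !mulf_neq0 ?invr_neq0.
- have : t ^+ 2 = (s ^+ (2 * N - j)) ^+ 2.
    have sE : s ^+ (2 * N) = s ^+ (2 * N - j) * s ^+ j by rewrite -exprD subnK.
    have qE : q ^+ N = s ^+ (2 * N) by rewrite -exprM.
    move: e; rewrite qE exprAC; move: (sX0 (2 * N)) (sX0 j) (sX0 (2 * N - j)).
    rewrite sE; move: (s ^+ (2 * N - j)) (s ^+ j) => r1 r2 r12 r20 r10 e.
    apply: (mulIf (mulf_neq0 r20 r20)).
    have -> : t ^+ 2 * (r2 * r2) = (t * r2 ^+ 2 / (r1 * r2)) * (t * (r1 * r2))
      by field; rewrite r10 r20.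
    by rewrite -e; field.
  (* If [t = s^(2N - j)], this exponent serves. If [t = - s^(2N - j)], then
     [th t = - th (s^(2N - j)) = th (s^j)], and [j] serves. *)
  move=> /eqP; rewrite eqf_sqr => /orP[]/eqP tE.
    by exists (2 * N - j)%N; rewrite ?leq_subr // tE.
  exists j => //; rewrite tE chain_th_opp -chain_thN //; congr th.
  by rewrite -{1}(subnK jN) exprD mulrAC mulfV // mul1r.
(* In the other case of [chain_th_eq] the unknown [t], possibly not real, cancels from the product
   of the two parameters, leaving a positive number equal to [- s^(2N)]. *)
- suff : 0 < - s ^+ (2 * N) by rewrite oppr_gt0 lt_gtF.
  rewrite -e; have -> : s ^+ (2 * N) / t * (t * q ^+ j / q ^+ N)
      = s ^+ (2 * N) * (q ^+ j / q ^+ N).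
    by move: (q ^+ j) (q ^+ N) (q0 N) (s ^+ (2 * N)) => *; field; apply/andP.
  by rewrite !mulr_gt0 ?invr_gt0 ?exprn_gt0.
Qed.

Lemma chain_th_inj k l : (k <= 2 * N)%N -> (l <= 2 * N)%N ->
  th (s ^+ k) = th (s ^+ l) -> k = l.
Proof.
move=> kN lN /chain_th_eq[]// [].
  exact: sX_inj.
move=> e; have : 0 < - s ^+ (2 * N) by rewrite -e mulr_gt0.
by rewrite oppr_gt0 lt_gtF.
Qed.

Lemma eigval_chain_pow t :
  0 < t -> eigval (th t) -> exists2 k, (k <= 2 * N)%N & t = s ^+ k.
Proof.
move=> t0 /eigval_chain[k kN /chain_th_eq[]//]; first by rewrite gt_eqF.
  by exists k.
move=> e; have : 0 < - s ^+ (2 * N) by rewrite -e mulr_gt0.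
by rewrite oppr_gt0 lt_gtF.
Qed.

(* If the eigenspace of index k0 + 2k were missing, then the sum of those before
   it in the chain would be stable under K, hence under S; but S maps index k0
   to 2N - k0. *)
Lemma chain_full k0 k : (k0 < 2)%N -> (k0 + 2 * k <= 2 * N - k0)%N ->
  eigval (th (s ^+ k0)) -> eigval (th (s ^+ (k0 + 2 * k))).
Proof.
move=> k02 kN [v v0 Av].
have [k0E|k_gt0] := posnP k; first by rewrite k0E muln0 addn0; exists v.
apply/eigvalP; apply: contraT => /eigvalP nE.
pose Q b := exists2 i, (i < k)%N & b = th (s ^+ (k0 + 2 * i)).
have QS : spec_in Q (S *m v).
  apply: (filtS (W := fun=> spec_in Q)) => [m u w|m r u|m u|m u //|].
  - exact: spec_inD.
  - exact: spec_inZ.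
  - apply: chain_stepQ => a _ [i ik ->]; exists (s ^+ (k0 + 2 * i)) => //;
    split=> // b eb [] bE.
    + case: i ik bE => [|i] ik bE; last first.
        exists i; first exact: ltnW.
        by rewrite bE mulnS addnCA exprD mulrC mulKf.
      (* The chain has nothing below its first term: [s^k0 / q] is not a power [s^l] with [l >= 0],
         because [k0 < 2]. *)
      have ek : eigval (th (s ^+ k0 / q)) by rewrite muln0 addn0 in bE;
        rewrite -bE.
      have [l _ lE] := eigval_chain_pow (divr_gt0 (sX_gt0 k0) (sX_gt0 2)) ek.
      have /sX_inj : s ^+ k0 = s ^+ (l + 2) by rewrite exprD -lE divfK.
      by lia.
    + by exists i.
    have bE' : b = th (s ^+ (k0 + 2 * i.+1)).
      by rewrite bE -exprD -addnA -mulnSr.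
    have [ik'|ki] := ltnP i.+1 k; first by exists i.+1.
    by case: nE; have -> : k = i.+1 by [lia]; rewrite -bE'.
  apply: (@spec_inW (eq^~ (th (s ^+ k0)))); last exact/spec_in_eigen.
  by move=> b ->; exists 0; rewrite ?muln0 ?addn0.
have SQ := (spec_in_eigen _ (S *m v)).1 (S_eigen Av).
have [b _ [bE [i ik]]] := spec_in_neq0 (S_neq0 v0) (spec_inI SQ QS).
(* The eigenvalue of [S *m v] has index [2N - k0], yet it equals [k0 + 2i] with [i < k],
   contradicting [k0 + 2k <= 2N - k0]. *)
rewrite bE -chain_thN // -{1}(subnK (_ : k0 <= 2 * N)%N); last by lia.
rewrite exprD mulfK // => /chain_th_inj; lia.
Qed.

Lemma chain_eigvals : (0 < N)%N -> eigval (th 1) -> eigval (th s) ->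
  forall k, (k <= 2 * N)%N -> eigval (th (s ^+ k)).
Proof.
move=> N0 e0 e1 k kN; rewrite -(odd_double_half k) -mul2n.
apply: chain_full; [by case: odd | | by case: odd].
by have := odd_double_half k; case: odd => /=; lia.
Qed.

(** A step of the parameter by [q = s^2] moves the index by 2, and a component whose index would
    leave [0..2N] vanishes because it belongs to no eigenvalue. The target [W] is arbitrary so that
    it can be the sum of neighbours in either ordering. *)
Lemma chain_tridiagonal (W : {vspace 'cV[C]_n}) k v : (k <= 2 * N)%N ->
  (forall l, (l <= 2 * N)%N -> [\/ l = k, l = (k + 2)%N | k = (l + 2)%N] ->
     (mx_eigenspace A (th (s ^+ l)) <= W)%VS) ->
  v \in mx_eigenspace A (th (s ^+ k)) -> K *m v \in W.
Proof.
move=> kN EW; rewrite mem_mx_eigenspace => /eqP /(chain_step (sX0 k)).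
apply: (@spec_in_ind _ (fun w => w \in W)) => [|u w|r u|a w ea aE Aw].
- exact: mem0v.
- exact: memvD.
- exact: memvZ.
have [t t0 [at_ tE]] : exists2 t, 0 < t &
    a = th t /\ [\/ t = s ^+ k / q, t = s ^+ k | t = s ^+ k * q].
  case: aE => ->; [exists (s ^+ k / q) | exists (s ^+ k) | exists (s ^+ k * q)];
    rewrite ?mulr_gt0 ?invr_gt0 //; split=> //;
    [exact: Or31 | exact: Or32 | exact: Or33].
rewrite at_ in ea Aw; have [l lN lE] := eigval_chain_pow t0 ea.
apply: (subvP (EW l lN _)); last by rewrite mem_mx_eigenspace -lE Aw.
case: tE; rewrite lE.
- by move/(canLR (divfK (sX0 2))); rewrite -exprD => /sX_inj; constructor 3.
- by move/sX_inj; constructor 1.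
- by rewrite -exprD => /sX_inj; constructor 2.
Qed.

Lemma chain_independent k : (k <= 2 * N)%N ->
  (mx_eigenspace A (th (s ^+ k)) :&:
   \sum_(j < (2 * N).+1 | (j : nat) != k) mx_eigenspace A (th (s ^+ j)))%VS
  = 0%VS.
Proof.
move=> kN; apply/eqP; rewrite -subv0; apply/subvP => v; rewrite memv_cap memv0.
case/andP; rewrite mem_mx_eigenspace =>
  /eqP /spec_in_eigen vk /memv_sumP[w wE vE].
apply: contraT => v0.
have vj : spec_in (fun a =>
  exists2 j, (j <= 2 * N)%N && (j != k) & a = th (s ^+ j)) v.
  rewrite vE; apply: big_ind => [|u u'|j jk];
    [exact: spec_in0 | exact: spec_inD |].
  apply: (@spec_inW (eq^~ (th (s ^+ j)))) => [a ->|].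
    by exists (j : nat); rewrite // jk -ltnS ltn_ord.
  by apply/spec_in_eigen/eqP; rewrite -mem_mx_eigenspace wE.
have [a _ [-> [j /andP[jN /eqP jk] /esym/chain_th_inj-jE]]] :=
  spec_in_neq0 v0 (spec_inI vk vj).
by case: jk; apply: jE.
Qed.

End SpectralChain.

(** * The Attenuated Space poset *)

Section AttenuatedMatrices.

Variables (R : realType) (F : finFieldType) (H : vectType F) (h : {vspace H}).
Implicit Types (x y z a b c : att_space h).

Local Notation C := R[i].
Local Notation q := (#|F|%:R : C).
Local Notation s := (sqrtq R F).
Local Notation att_mx := (@att_mx R F H h).

Lemma sqrtq_gt1 : 1 < s.
Proof.
rewrite /sqrtq -[1](rmorph1 (real_complex R)) ltcR -[X in X < _]sqrtr1 ltr_sqrt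
  ?ltr0n.
  by rewrite ltr1n finNzRing_gt1.
by rewrite (ltn_trans _ (finNzRing_gt1 F)).
Qed.

Lemma sqrtq_gt0 : 0 < s. Proof. exact: lt_trans ltr01 sqrtq_gt1. Qed.

Lemma sqrtq_neq0 : s != 0. Proof. exact: lt0r_neq0 sqrtq_gt0. Qed.

Lemma sqr_sqrtq : s ^+ 2 = q.
Proof.
by rewrite /sqrtq -(rmorphXn (real_complex R)) /= sqr_sqrtr ?ler0n //
  rmorph_nat.
Qed.

Lemma att_mxM f g :
  att_mx f *m att_mx g = att_mx (fun y z => \sum_a f y a * g a z).
Proof.
apply/matrixP => i j; rewrite !mxE.
rewrite (reindex_onto enum_rank enum_val) /=; last first.
  by move=> k _; rewrite enum_valK.
rewrite (eq_bigl predT) => [|a]; last by rewrite enum_rankK eqxx.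
by apply: eq_bigr => a _; rewrite !mxE !enum_rankK.
Qed.

Lemma eq_att_mx f g : (forall y z, f y z = g y z) -> att_mx f = att_mx g.
Proof. by move=> fg; apply/matrixP => i j; rewrite !mxE fg. Qed.

Lemma att_mxD f g : att_mx f + att_mx g = att_mx (fun y z => f y z + g y z).
Proof. by apply/matrixP => i j; rewrite !mxE. Qed.

Lemma att_mxZ k f : k *: att_mx f = att_mx (fun y z => k * f y z).
Proof. by apply/matrixP => i j; rewrite !mxE. Qed.

Lemma att_mxN f : - att_mx f = att_mx (fun y z => - f y z).
Proof. by apply/matrixP => i j; rewrite !mxE. Qed.

Lemma trmx_att f : (att_mx f)^T = att_mx (fun y z => f z y).
Proof. by apply/matrixP => i j; rewrite !mxE. Qed.

Definition att_diag (f : nat -> C) : 'M[C]_#|att_space h| :=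
  att_mx (fun y z => if y == z then f (\dim (sp y)) else 0).

Lemma att_diag_mulmx f g :
  att_diag f *m att_mx g = att_mx (fun y z => f (\dim (sp y)) * g y z).
Proof.
rewrite att_mxM; apply: eq_att_mx => y z;
  rewrite (bigD1 y) //= eqxx big1 ?addr0 //.
by move=> a; rewrite eq_sym => /negPf ->; rewrite mul0r.
Qed.

Lemma mulmx_att_diag f g :
  att_mx g *m att_diag f = att_mx (fun y z => g y z * f (\dim (sp z))).
Proof.
rewrite att_mxM; apply: eq_att_mx => y z;
  rewrite (bigD1 z) //= eqxx big1 ?addr0 //.
by move=> a /negPf ->; rewrite mulr0.
Qed.

(* Conjugation by the weight s^C(dim, 2) turns the raising part of A into
   raise_mx and the lowering part into its transpose. *)
Definition raise_mx : 'M[C]_#|att_space h| :=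
  att_mx (fun y z => (covers y z)%:R * s ^+ \dim (sp z)).

Local Notation U := raise_mx.
Local Notation D := (raise_mx^T).

Variables N M : nat.
Hypotheses (N0 : (0 < N)%N) (M0 : (0 < M)%N).
Hypotheses (dimH : \dim (fullv : {vspace H}) = (N + M)%N) (dimh : \dim h = M).

Local Notation A := (attA R h).
Local Notation K := (attAstar R h).
Local Notation th := (chain_th s (s ^+ M / (q - 1)) N).

(** The [(y, x)] entries count weighted paths from [x] to [y]: [UUD] goes down, up, up; [UDU] goes
    up, down, up; [DUU] goes up, up, down. They vanish unless [dim y = dim x + 1]. In that case all
    paths of one type have the same weight, and the path counts express the middle number through
    the other two. *)
Lemma raise_relation :
  q ^+ 3 *: (U *m U *m D) - (q * (q + 1)) *: (U *m D *m U) + D *m U *m U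
  = - (q ^+ (N + M) * (q + 1)) *: U.
Proof.
have qs : q = s ^+ 2 by rewrite sqr_sqrtq.
rewrite -(mulmxA D) trmx_att /raise_mx !att_mxM !att_mxZ att_mxN !att_mxD.
apply: eq_att_mx => y x.
have [dy|dyN] := eqVneq (\dim (sp y)) (\dim (sp x)).+1; last first.
  rewrite !big1 ?mulr0 ?addr0 ?subr0.
  - by case: coversP => [[_ /eqP]|_]; rewrite ?(negPf dyN) // !mul0r mulr0.
  - move=> c _; case: coversP => [[_ dc]|]; last by rewrite !mul0r.
    rewrite big1 ?mulr0 // => b _; case: coversP => [[_ db]|];
      last by rewrite !mul0r.
    case: coversP => [[_ dx]|]; last by rewrite !mul0r mulr0.
    by case/eqP: dyN; lia.
  - move=> b _; case: coversP => [[_ db]|]; last by rewrite !mul0r mulr0.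
    rewrite big1 ?mul0r // => a _; case: coversP => [[_ da]|];
      last by rewrite !mul0r.
    case: coversP => [[_ dx]|]; last by rewrite !mul0r mulr0.
    by case/eqP: dyN; lia.
  - move=> b _; case: (coversP x b) => [[_ db]|]; last by rewrite !mul0r mulr0.
    rewrite big1 ?mul0r // => a _; case: coversP => [[_ da]|];
      last by rewrite !mul0r.
    case: coversP => [[_ dx]|]; last by rewrite !mul0r mulr0.
    by case/eqP: dyN; lia.
pose i : nat := \dim (sp x).
(* The lowest vertex has dimension [i - 1], so such a path has weight [s^(3i - 2)]; the factor
   [q = s^2] avoids a truncated subtraction. *)
have e1 : q * (\sum_b (\sum_a (covers y a)%:R * s ^+ \dim (sp a) *
      ((covers a b)%:R * s ^+ \dim (sp b))) *
        ((covers x b)%:R * s ^+ \dim (sp b)))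
    = s ^+ (3 * i) * (q + 1) *
      (\sum_(b : att_space h) covers x b * (sp b <= sp y)%VS)%N%:R.
  rewrite natr_sum !mulr_sumr; apply: eq_bigr => b _.
  case: (coversP x b) => [[_ db]|]; last by rewrite !mul0r !mulr0.
  have -> : \sum_a (covers y a)%:R * s ^+ \dim (sp a) *
      ((covers a b)%:R * s ^+ \dim (sp b))
      = (q + 1) * (sp b <= sp y)%VS%:R * s ^+ (i + \dim (sp b)).
    rewrite -[_ + 1](natrD _ _ 1%N) addn1 -natrM -sum_between;
      last by rewrite dy db.
    rewrite natr_sum mulr_suml; apply: eq_bigr => a _; rewrite natrM.
    case: (coversP y a) => [[_ da]|]; last by rewrite !mul0r.
    have -> : \dim (sp a) = i by rewrite /i; lia.
    by rewrite exprD mulrACA.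
  rewrite mul1n; move: ((sp b <= sp y)%VS%:R : C) => u;
    have -> : (3 * i = 2 + (i + \dim (sp b)) + \dim (sp b))%N by rewrite /i;
    lia.
  by rewrite /= mulr1n mul1r qs !exprD; ring.
have e2 : \sum_b (\sum_a (covers y a)%:R * s ^+ \dim (sp a) *
      ((covers b a)%:R * s ^+ \dim (sp a))) *
        ((covers b x)%:R * s ^+ \dim (sp x))
    = s ^+ (3 * i) * (\sum_(b : att_space h) covers b x *
        \sum_(a : att_space h) covers y a * covers b a)%N%:R.
  rewrite natr_sum !mulr_sumr; apply: eq_bigr => b _.
  case: (coversP b x) => [[_ db]|]; last by rewrite !mul0r !mulr0.
  rewrite mul1n natr_sum mulr_sumr mulr_suml; apply: eq_bigr => a _;
    rewrite natrM.
  case: (coversP y a) => [[_ da]|]; last by rewrite !mul0r mulr0.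
  have -> : \dim (sp a) = i by rewrite /i; lia.
  have -> : (3 * i = i + i + i)%N by lia.
  rewrite -/i /= mulr1n mul1r !exprD.
  move: ((covers b a)%:R : C) => u; ring.
have e3 : \sum_c (covers c y)%:R * s ^+ \dim (sp y) *
      (\sum_b (covers c b)%:R * s ^+ \dim (sp b) *
         ((covers b x)%:R * s ^+ \dim (sp x)))
    = q * s ^+ (3 * i) * (q + 1) *
      (\sum_(c : att_space h) covers c y * (sp x <= sp c)%VS)%N%:R.
  rewrite natr_sum !mulr_sumr; apply: eq_bigr => c _.
  case: (coversP c y) => [[_ dc]|]; last by rewrite !mul0r !mulr0.
  have -> : \sum_b (covers c b)%:R * s ^+ \dim (sp b) *
      ((covers b x)%:R * s ^+ \dim (sp x))
      = (q + 1) * (sp x <= sp c)%VS%:R * s ^+ (i.+1 + i).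
    rewrite -[_ + 1](natrD _ _ 1%N) addn1 -natrM -sum_between;
      last by rewrite dc dy.
    rewrite natr_sum mulr_suml; apply: eq_bigr => b _; rewrite natrM.
    case: (coversP b x) => [[_ db]|]; last by rewrite !mul0r !mulr0 mul0r.
    rewrite db -/i exprD /= mulr1n mul1r; move: ((covers c b)%:R : C) => u;
      ring.
  rewrite qs dy mul1n; have -> : (3 * i = i + i + i)%N by lia.
  rewrite -/i /= mulr1n mul1r !exprS !exprD;
    move: ((sp x <= sp c)%VS%:R : C) => u; ring.
have cyx : covers y x = (sp x <= sp y)%VS by apply/coversP/idP => [[]|] //.
have path : (\sum_(b : att_space h) covers b x *
        \sum_(a : att_space h) covers y a * covers b a)%N%:R
    = q * (\sum_(b : att_space h) covers x b * (sp b <= sp y)%VS)%N%:R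
     + (\sum_(c : att_space h) covers c y * (sp x <= sp c)%VS)%N%:R
     + q ^+ (N + M - i.+1) * (covers y x)%:R.
  rewrite -natrX -!natrM -!natrD; congr _%:R.
  case: (boolP (covers y x)) => [c_yx|];
    first by rewrite muln1 (path_count_sub dimH).
  by rewrite cyx muln0 addn0 => nxy; apply: path_count_nsub.
(* This matches the constant with the extra term of [path_count_sub], using [q^i = (s^i)^2]. *)
have -> : q ^+ (N + M) = q * q ^+ (N + M - i.+1) * (s ^+ i) ^+ 2.
  rewrite exprAC -qs -exprS -exprD; congr (_ ^+ _).
  have : (\dim (sp y) <= N + M)%N by rewrite -dimH dimvS ?subvf.
  by rewrite dy /i; lia.
rewrite exprSr -mulrA e1 e2 e3 path -/i mulnC exprM.
by ring.
Qed.

Lemma attAstarE : K = att_diag (fun i => q ^- i).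
Proof. by []. Qed.

Lemma tr_att_diag f : (att_diag f)^T = att_diag f.
Proof.
by rewrite trmx_att; apply: eq_att_mx => y z; rewrite eq_sym;
  case: eqP => // ->.
Qed.

Lemma att_diagM f g : att_diag f *m att_diag g = att_diag (fun i => f i * g i).
Proof.
by rewrite att_diag_mulmx; apply: eq_att_mx => y z; case: eqP; rewrite ?mulr0.
Qed.

Lemma att_diag1 : att_diag (fun=> 1) = 1%:M.
Proof.
by apply/matrixP => i j; rewrite !mxE (inj_eq enum_val_inj); case: eqP.
Qed.

Lemma q_neq0 : q != 0.
Proof. by rewrite -sqr_sqrtq expf_neq0 ?sqrtq_neq0. Qed.

Lemma q1_neq0 : q - 1 != 0.
Proof. by rewrite subr_eq0 pnatr_eq1 gtn_eqF ?finNzRing_gt1. Qed.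

Lemma raise_Astar : U *m K = q *: (K *m U).
Proof.
rewrite attAstarE mulmx_att_diag att_diag_mulmx att_mxZ.
apply: eq_att_mx => y z; case: coversP => [[_ ->]|];
  last by rewrite !mul0r !mulr0.
exact: divf_exprS q_neq0.
Qed.

Lemma lower_Astar : D *m K = q^-1 *: (K *m D).
Proof.
have := congr1 trmx raise_Astar;
  rewrite linearZ /= !trmx_mul attAstarE tr_att_diag.
by move=> ->; rewrite scalerA mulVf ?q_neq0 // scale1r.
Qed.

Definition att_weight : 'M[C]_#|att_space h| :=
  att_diag (fun i => s ^+ 'C(i, 2)).

Local Notation V := att_weight.

Lemma att_weight_unit : V \in unitmx.
Proof.
apply: (proj1 (mulmx1_unit (B := att_diag (fun i => s ^- 'C(i, 2))) _)).
rewrite att_diagM -att_diag1; apply: eq_att_mx => y z; rewrite mulfV //.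
by rewrite expf_neq0 ?sqrtq_neq0.
Qed.

Lemma att_weightA : V *m A = (U + D) *m V.
Proof.
rewrite trmx_att att_mxD att_diag_mulmx mulmx_att_diag.
apply: eq_att_mx => y z; case: (coversP y z) => [[_ yz]|_].
  case: coversP => [[_ zy]|_]; first by lia.
  by rewrite yz binS bin1 exprD mul0r addr0 mul1r mulr1 mulrC.
case: coversP => [[_ zy]|_]; last by rewrite !mul0r addr0 mulr0 mul0r.
rewrite zy binS bin1 exprD -sqr_sqrtq -/(sp y) exprAC /= mulr1n.
by move: (s ^+ 'C(_, _)) (s ^+ \dim _) => u v; ring.
Qed.

Lemma att_weight_Astar : V *m K = K *m V.
Proof.
by rewrite attAstarE !att_diagM; apply: eq_att_mx => y z; rewrite mulrC.
Qed.

Lemma attA_diagonalizable :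
  exists P d, P \in unitmx /\ A = invmx P *m diag_mx d *m P.
Proof.
have hB : (U + D) \is hermsymmx.
  apply: realsym_hermsym; last first.
    apply/mxOverP => i j; rewrite !mxE.
    by rewrite rpredD // rpredM ?rpredX ?realn // ger0_real ?(ltW sqrtq_gt0).
  by apply/is_hermitianmxP;
    rewrite expr0 scale1r map_mx_id //= trmxD trmxK addrC.
exact: similar_hermitian_diagonalizable hB att_weight_unit att_weightA.
Qed.

Lemma attA_cubic :
  A *m A *m A *m K - (q + q^-1 + 1) *: (A *m A *m K *m A)
    + (q + q^-1 + 1) *: (A *m K *m A *m A) - K *m A *m A *m A
  = (q ^+ (N + M) * (q + 1) * (q + 1) / q ^+ 2) *: (A *m K - K *m A).
Proof.
have relD : q ^+ 3 *: (U *m D *m D) - (q * (q + 1)) *: (D *m U *m D)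
      + D *m D *m U
    = - (q ^+ (N + M) * (q + 1)) *: D.
  have := congr1 trmx raise_relation.
  rewrite trmxD trmxB !trmxZ !trmx_mul trmxK => <-.
  by rewrite !mulmxA.
have e := cubic_relation q_neq0 raise_Astar lower_Astar raise_relation relD.
exact: similar_cubic att_weight_unit att_weightA att_weight_Astar e.
Qed.

(** * Diagonal matrices as polynomials in A* *)

Lemma att_dim_leN z : (\dim (sp z) <= N)%N.
Proof.
have /eqP/dimv_disjoint_sum := attP z; rewrite dimh => e.
by have := dimvS (subvf (sp z + h)%VS); rewrite e dimH; lia.
Qed.

Lemma qV_inj : injective (fun i => q ^- i : C).
Proof.
move=> i j /invr_inj; rewrite -sqr_sqrtq -!exprM => /(ieexprIn sqrtq_gt0).
by rewrite gt_eqF ?sqrtq_gt1 // => /(_ isT); lia.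
Qed.

Lemma att_diag_polyM (p r : {poly C}) :
  att_diag (fun i => (p * r).[q ^- i])
  = att_diag (fun i => p.[q ^- i]) *m att_diag (fun i => r.[q ^- i]).
Proof. by rewrite att_diagM; apply: eq_att_mx => y z; rewrite hornerM. Qed.

Lemma att_diag_polyD (p r : {poly C}) :
  att_diag (fun i => (p + r).[q ^- i])
  = att_diag (fun i => p.[q ^- i]) + att_diag (fun i => r.[q ^- i]).
Proof.
by rewrite att_mxD; apply: eq_att_mx => y z; case: eqP;
  rewrite ?addr0 // hornerD.
Qed.

Lemma att_diag_polyC (a : C) : att_diag (fun i => (a%:P).[q ^- i]) = a *: 1%:M.
Proof.
rewrite -att_diag1 att_mxZ; apply: eq_att_mx => y z.
by case: eqP; rewrite ?mulr0 // hornerC mulr1.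
Qed.

Lemma att_diag_polyX : att_diag (fun i => ('X).[q ^- i]) = K.
Proof. by apply: eq_att_mx => y z; rewrite hornerX. Qed.

(** Only dimensions from 0 to [N] occur, so it suffices to interpolate at the [N + 1] distinct
    points [q^-i]. *)
Lemma att_diag_interpolation f : exists2 p : {poly C}, (size p <= N.+1)%N &
  att_diag f = att_diag (fun i => p.[q ^- i]).
Proof.
have [|p sp pE] := @poly_interpolation C (fun i => q ^- i) f N.+1.
  by move=> i j _ _; apply: qV_inj.
exists p => //; apply: eq_att_mx => y z; rewrite pE // ltnS; exact: att_dim_leN.
Qed.

(** [W m] stands for what at most [m] applications of [K] reach from [v]. In the Horner form of the
    interpolating polynomial each degree costs one multiplication by [K], and the degree is at most
    [N]. With [f] the sign function this supplies the filtration hypothesis on [S] for the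
    chains. *)
Lemma att_diag_filtered (f : nat -> C)
    (W : nat -> 'cV[C]_#|att_space h| -> Prop) v :
  (forall m u w, W m u -> W m w -> W m (u + w)) ->
  (forall m (r : C) u, W m u -> W m (r *: u)) ->
  (forall m u, W m u -> W m.+1 (K *m u)) ->
  (forall m u, W m u -> W m.+1 u) ->
  W 0 v -> W N (att_diag f *m v).
Proof.
move=> WD WZ WK WS W0; have [p sp ->] := att_diag_interpolation f.
have {W0} Wm m : W m v by elim: m => [|m /WS].
move: (N) sp => m; elim/poly_ind: p m => [|p a IH] m sp.
  by rewrite (att_diag_polyC 0) scale0r mul0mx -(scale0r v); apply: WZ.
rewrite mulrC att_diag_polyD att_diag_polyM att_diag_polyX att_diag_polyC
  mulmxDl.
apply: (WD); last by rewrite -scalemxAl mul1mx; apply: WZ.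
case: m sp => [|m] sp.
  (* At level 0 the polynomial [p * 'X + a%:P] has size at most 1, so it is constant. *)
  have -> : p = 0.
    apply/eqP; rewrite -size_poly_eq0; have := sp.
    by rewrite size_MXaddC; case: ifP => [/andP[/eqP -> _]|_];
      rewrite ?size_poly0 // ltnS leqn0.
  by rewrite (att_diag_polyC 0) scale0r mulmx0 mul0mx -(scale0r v); apply: WZ.
rewrite -mulmxA; apply: WK; apply: IH; have := sp.
by rewrite size_MXaddC; case: ifP => [/andP[/eqP -> _]|_]; rewrite ?size_poly0.
Qed.

Lemma att_diag_subalgebra f (T : {vspace 'M[C]_#|att_space h|}) :
  subalgebra_mx T -> K \in T -> att_diag f \in T.
Proof.
move=> [T1 TM] TK; have [p _ ->] := att_diag_interpolation f.
elim/poly_ind: p => [|p a IH];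
  first by rewrite (att_diag_polyC 0) scale0r mem0v.
rewrite mulrC att_diag_polyD att_diag_polyM att_diag_polyX att_diag_polyC.
by rewrite memvD ?memvZ //; apply: TM.
Qed.

Definition att_sign : 'M[C]_#|att_space h| := att_diag (fun i => (-1) ^+ i).

Lemma att_signK : att_sign *m att_sign = 1%:M.
Proof.
rewrite att_diagM -att_diag1; apply: eq_att_mx => y z.
by rewrite -exprD addnn -mul2n exprM sqrrN expr1n expr1n.
Qed.

Lemma att_signA : att_sign *m A = - (A *m att_sign).
Proof.
rewrite att_diag_mulmx mulmx_att_diag att_mxN; apply: eq_att_mx => y z.
case: coversP => [[_ ->]|_]; first by rewrite exprS; ring.
case: coversP => [[_ ->]|_]; first by rewrite exprS; ring.
by rewrite mulr0 mul0r oppr0.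
Qed.

(** * Explicit eigenvectors for the starts of the two chains *)

Lemma sum_up_covers_mem (v : H) y :
  (\sum_(c : att_space h) covers c y * (v \in sp c)
   = (v \in sp y) * (\sum_(c : att_space h) covers c y)
     + (v \notin sp y + h)%VS)%N.
Proof.
have [vy|vy] := boolP (v \in sp y).
  rewrite mul1n (subvP (addvSl _ _) _ vy) addn0; apply: eq_bigr => c _.
  by case: coversP => [[yc _]|_]; rewrite ?(subvP yc).
rewrite mul0n add0n; under eq_bigr => c _ do rewrite mulnb.
rewrite (sum_att h (fun Z : {vspace H} =>
  ((sp y <= Z)%VS && (\dim Z == (\dim (sp y)).+1)) && (v \in Z))).
have dyv := dim_addv_line vy.
have sub_h : (sp y + <[v]> <= sp y + h)%VS = (v \in sp y + h)%VS.
  by rewrite subv_add addvSl memvE.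
(* The only candidate for a cover of [y] containing [v] is [y + <[v]>], and by [cover_capv0] it
   avoids [h] exactly when [v] is outside [y + h]. *)
have [vh|vh] := boolP (v \in (sp y + h)%VS).
  apply: eq_card0 => Z; rewrite !inE; apply: contraTF vh.
  case/and3P=> Zh /andP[yZ /eqP dZ] vZ; rewrite -sub_h.
  have -> : (sp y + <[v]>)%VS = Z by apply/eqP; rewrite addv_line_eq.
  by rewrite -(cover_capv0 (attP y) yZ dZ).
apply/eqP/cards1P; exists (sp y + <[v]>)%VS; apply/setP => Z; rewrite !inE.
apply/idP/eqP => [/and3P[_ /andP[yZ /eqP dZ] vZ]|->].
  by apply/esym/eqP; rewrite addv_line_eq.
by rewrite (cover_capv0 (attP y)) ?addvSl // sub_h vh dyv eqxx memv_addv_line.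
Qed.

Lemma muln_qintR n : (q - 1) * (qint F n)%:R = q ^+ n - 1.
Proof.
have q1 : (0 < #|F|)%N by apply: ltnW; apply: finNzRing_gt1.
rewrite -[_ - 1](natrB _ q1) subn1 -natrM muln_qint natrB ?natrX //.
by rewrite expn_gt0 q1.
Qed.

Lemma mulr_sum_up_covers y :
  (q - 1) * (\sum_(c : att_space h) covers c y)%N%:R
  = q ^+ M * (q ^+ N / q ^+ \dim (sp y) - 1).
Proof.
have /(congr1 (fun m => (q - 1) * m%:R)) := sum_up_covers y dimH dimh.
rewrite natrD mulrDr !muln_qintR => /(canRL (addrK _)) ->.
have le_yN := att_dim_leN y.
have -> : (N + M - \dim (sp y) = M + (N - \dim (sp y)))%N by lia.
have -> : q ^+ N = q ^+ (N - \dim (sp y)) * q ^+ \dim (sp y).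
  by rewrite -exprD subnK.
by rewrite mulfK ?expf_neq0 ?q_neq0 // exprD mulrBr mulr1 opprB addrA subrK.
Qed.

Definition att_vec (f : att_space h -> C) : 'cV[C]_#|att_space h| :=
  \col_i f (enum_val i).

Lemma attA_vec f : A *m att_vec f =
  att_vec (fun y => \sum_a (covers y a)%:R * f a
    + q ^+ \dim (sp y) * (\sum_a (covers a y)%:R * f a)).
Proof.
apply/matrixP => i j; rewrite !mxE.
rewrite (reindex_onto enum_rank enum_val) /=; last first.
  by move=> k _; rewrite enum_valK.
rewrite (eq_bigl predT) => [|a]; last by rewrite enum_rankK eqxx.
rewrite mulr_sumr -big_split /=; apply: eq_bigr => a _; rewrite !mxE enum_rankK.
case: coversP => [[_ da]|_].
  case: coversP => [[_ da']|_].
    by move: (\dim _) (\dim _) da da' => d1 d2; lia.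
  by rewrite mul0r mulr0 addr0.
by case: coversP => [_|_]; rewrite ?mul0r ?mulr0 add0r ?mul1r.
Qed.

(** The weight [s^-((M + k) dim)] multiplies the lower sum by [s^(M + k)] and the upper sum by its
    inverse. With these factors the two terms in [q^(dim y)] cancel, leaving a constant multiple of
    the vector. *)
Lemma attA_eigenvector k (chi : att_space h -> C) :
  (forall y, (q - 1) * (\sum_a (covers y a)%:R * chi a)
     = (q ^+ \dim (sp y) / q ^+ k - 1) * chi y) ->
  (forall y, (q - 1) * (\sum_a (covers a y)%:R * chi a)
     = q ^+ M * (q ^+ N / q ^+ \dim (sp y) - 1) * chi y) ->
  A *m att_vec (fun y => s ^- ((M + k) * \dim (sp y)) * chi y)
  = th (s ^+ k) *: att_vec (fun y => s ^- ((M + k) * \dim (sp y)) * chi y).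
Proof.
move=> down up; rewrite attA_vec; apply/matrixP => i j; rewrite !mxE.
move: (enum_val i) => y.
apply: (mulfI q1_neq0); have q1 := q1_neq0.
have e1 : \sum_a (covers y a)%:R * (s ^- ((M + k) * \dim (sp a)) * chi a)
   = s ^+ (M + k) * s ^- ((M + k) * \dim (sp y)) *
     (\sum_a (covers y a)%:R * chi a).
  rewrite mulr_sumr; apply: eq_bigr => a _.
  case: coversP => [[_ ->]|_]; last by rewrite !mul0r mulr0.
  move: (M + k)%N => m;
    by rewrite mulnS exprD invfM mulVKf ?expf_neq0 ?sqrtq_neq0 // !mul1r.
have e2 : \sum_a (covers a y)%:R * (s ^- ((M + k) * \dim (sp a)) * chi a)
   = s ^- (M + k) * s ^- ((M + k) * \dim (sp y)) *
     (\sum_a (covers a y)%:R * chi a).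
  rewrite mulr_sumr; apply: eq_bigr => a _.
  case: coversP => [[_ ->]|_]; last by rewrite !mul0r mulr0.
  by move: (M + k)%N => m; rewrite mulnS exprD invfM !mul1r.
rewrite e1 e2 /chain_th.
have qX n : q ^+ n = s ^+ n * s ^+ n by rewrite -sqr_sqrtq exprAC expr2.
have -> X Y Z : (q - 1) * (X * Y + Z) = X * ((q - 1) * Y) + (q - 1) * Z.
  by rewrite mulrDr mulrCA.
have -> X Y Z : (q - 1) * (X * (Y * Z)) = X * Y * ((q - 1) * Z).
  by rewrite -mulrA mulrCA; congr (_ * _); rewrite mulrCA.
rewrite down up.
have -> : s ^+ (2 * N) = q ^+ N by rewrite exprM sqr_sqrtq.
have -> X Y Z : (q - 1) * (X * (Y / (q - 1)) * Z) = X * Y * Z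
  by move=> *; field.
rewrite exprD !qX.
have := sqrtq_neq0 => s0.
have : s ^+ M != 0 by rewrite expf_neq0.
have : s ^+ k != 0 by rewrite expf_neq0.
have : s ^+ \dim (sp y) != 0 by rewrite expf_neq0.
have : s ^+ ((M + k) * \dim (sp y)) != 0 by rewrite expf_neq0.
move: (s ^+ ((M + k) * \dim (sp y))) (s ^+ \dim (sp y)) (s ^+ k) (s ^+ M)
  (s ^+ N) (chi y) => r1 r2 r3 r4 r5 r6 *.
by field; do ![apply/andP; split].
Qed.

Lemma sqrtq_expV_neq0 n : s ^- n != 0.
Proof. by rewrite invr_neq0 ?expf_neq0 ?sqrtq_neq0. Qed.

(** The constant function [chi = 1] fits with [k = 0], since the numbers of lower and upper covers
    of [y] depend only on [dim y]. *)
Lemma attA_eigenvector0 :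
  exists2 v : 'cV[C]_#|att_space h|, v != 0 & A *m v = th 1 *: v.
Proof.
exists (att_vec (fun y : att_space h => s ^- ((M + 0) * \dim (sp y)) * 1));
  last first.
  rewrite -[in RHS](expr0 s); apply: attA_eigenvector => y.
  - under eq_bigr => a _ do rewrite mulr1.
    by rewrite -natr_sum sum_down_covers muln_qintR divr1 mulr1.
  - under eq_bigr => a _ do rewrite mulr1.
    by rewrite -natr_sum mulr_sum_up_covers mulr1.
pose y0 : att_space h := exist _ 0%VS (introT eqP (cap0v h)).
apply/eqP => /matrixP/(_ (enum_rank y0) 0); rewrite !mxE mulr1 => /eqP.
exact/negP/sqrtq_expV_neq0.
Qed.

(* Up to a weight, the vector is the difference of the indicators of v1 and
   v2 = v1 + p with p in h: for y containing neither, as many covers of y contain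
   v1 as v2, since v1 and v2 agree modulo h. *)
Lemma attA_eigenvector1 :
  exists2 v : 'cV[C]_#|att_space h|, v != 0 & A *m v = th s *: v.
Proof.
have [v1 v1h] : exists v1, v1 \notin h.
  have : ~~ (fullv <= h)%VS.
    by apply/negP => /dimvS; rewrite dimH dimh; lia.
  by case/subvPn => v _ vh; exists v.
pose p := vpick h; have p0 : p != 0.
  by rewrite vpick0 -dimv_eq0 dimh -lt0n.
have ph : p \in h by apply: memv_pick.
pose v2 := v1 + p.
pose chi y : C := (v1 \in sp y)%:R - (v2 \in sp y)%:R.
(* Requiring [a] to contain the line [<[v]>] lowers the dimension in the count by one, which is the
   division by [q] expected for [k = 1]. *)
have down v y : v != 0 -> (q - 1) * (\sum_a (covers y a)%:R * (v \in sp a)%:R)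
     = (q ^+ \dim (sp y) / q - 1) * (v \in sp y)%:R.
  move=> v0; have [vy|vy] := boolP (v \in sp y); last first.
    rewrite big1 ?mulr0 // => a _; case: coversP => [[ay _]|];
      last by rewrite mul0r.
    by rewrite (negPf (contra (subvP ay v) vy)) mulr0.
  rewrite (eq_bigr (fun a => (covers y a * (<[v]> <= sp a)%VS)%N%:R)) =>
    [|a _]; last by rewrite natrM memvE.
  rewrite -natr_sum sum_down_covers_sub; last by rewrite -memvE.
  rewrite muln_qintR dim_vline v0 mulr1.
  have : (\dim <[v]> <= \dim (sp y))%N by rewrite dimvS // -memvE.
  rewrite dim_vline v0; case: (\dim _) => // d _.
  by rewrite subn1 /= exprSr mulfK // q_neq0.
have up v y : (q - 1) * (\sum_a (covers a y)%:R * (v \in sp a)%:R)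
     = q ^+ M * (q ^+ N / q ^+ \dim (sp y) - 1) * (v \in sp y)%:R
       + (q - 1) * (v \notin sp y + h)%VS%:R.
  under eq_bigr => a _ do rewrite -natrM.
  rewrite -natr_sum sum_up_covers_mem natrD mulrDr natrM mulrCA.
  by rewrite mulr_sum_up_covers mulrC.
have v10 : v1 != 0 by apply: contra v1h => /eqP ->; apply: mem0v.
have v2h : v2 \notin h by rewrite rpredDr.
have v20 : v2 != 0 by apply: contra v2h => /eqP ->; apply: mem0v.
exists (att_vec (fun y => s ^- ((M + 1) * \dim (sp y)) * chi y)); last first.
  rewrite -[in RHS](expr1 s); apply: attA_eigenvector => y.
  - rewrite /chi; under eq_bigr => a _ do rewrite mulrBr.
    by rewrite sumrB mulrBr !down // mulrBr expr1.
  - rewrite /chi; under eq_bigr => a _ do rewrite mulrBr.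
    rewrite sumrB mulrBr !up [RHS]mulrBr.
    have -> : (v2 \in (sp y + h)%VS) = (v1 \in (sp y + h)%VS).
      by rewrite rpredDr // (subvP (addvSr _ _)).
    by rewrite opprD addrACA subrr addr0.
have y1h : (<[v1]> :&: h == 0)%VS.
  rewrite -subv0; apply/subvP => w; rewrite memv_cap => /andP[/vlineP[k ->]].
  by rewrite rpredZeq (negPf v1h) orbF => /eqP ->; rewrite scale0r mem0v.
(* The vector is nonzero at the line of [v1]: if [v2] were on it, then the nonzero [p] would be a
   multiple of [v1], forcing [v1] into [h]. *)
pose y1 : att_space h := exist _ <[v1]>%VS y1h.
apply/eqP => /matrixP/(_ (enum_rank y1) 0); rewrite !mxE enum_rankK => /eqP.
apply/negP; rewrite mulf_neq0 ?sqrtq_expV_neq0 // /chi -[sp y1]/(<[v1]>%VS).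
rewrite memv_line; have -> : (v2 \in <[v1]>%VS) = false.
  apply: contraNF v1h => /vlineP[k kE].
  have pE : p = (k - 1) *: v1 by rewrite scalerBl scale1r -kE /v2 addrC addKr.
  move: ph p0; rewrite pE rpredZeq scaler_eq0 => /orP[/eqP ->|//].
  by rewrite eqxx.
by rewrite subr0 oner_eq0.
Qed.

(** * The algebra M*, the eigenspaces of A, and dual adjacency *)

Lemma attMstar_att_diag f : att_diag f \in attMstar R h N.
Proof.
have -> : att_diag f = \sum_(i < N.+1) f i *: attEstar R h i.
  apply/matrixP => i j; rewrite summxE !mxE; set y := enum_val i;
    set z := enum_val j.
  rewrite (eq_bigr (fun k : 'I_N.+1 => if k == inord (\dim (sp y)) then
     (if y == z then f (\dim (sp y)) else 0) else 0)) => [|k _].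
    by rewrite -big_mkcond big_pred1_eq.
  have kE : (k == inord (\dim (sp y))) = (\dim (sp y) == k).
    by rewrite eq_sym -val_eqE /= inordK // ltnS att_dim_leN.
  rewrite !mxE -/y -/z kE -/(sp y); case: (\dim (sp y) =P k) => [->|];
    last by rewrite andbF mulr0.
  by rewrite andbT; case: (y == z); rewrite ?mulr1 ?mulr0.
apply: memv_suml => i _; apply/memvZ/memv_span/map_f.
by rewrite mem_iota /= add0n.
Qed.

Lemma attEstarE i : attEstar R h i = att_diag (fun j => (j == i)%:R).
Proof. by apply: eq_att_mx => y z; case: (y == z). Qed.

Lemma mem_attMstar X : X \in attMstar R h N -> exists f, X = att_diag f.
Proof.
move/coord_span ->; apply: (big_ind (fun X => exists f, X = att_diag f)) =>
  [|_ _ [f ->] [g ->]|i _].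
- exists (fun=> 0); apply/matrixP => i j; rewrite !mxE; by case: ifP.
- exists (fun i => f i + g i); rewrite att_mxD; apply: eq_att_mx => y z.
  by case: ifP; rewrite ?addr0.
set c := coord _ _ _; set t := map_tuple _ _.
have /mapP[k _ ->] : t`_i \in t by rewrite mem_nth ?size_tuple.
exists (fun j => c * (j == k)%:R); rewrite attEstarE att_mxZ;
  apply: eq_att_mx => y z.
by case: ifP; rewrite ?mulr0.
Qed.

Lemma attAstar_generates : generates K (attMstar R h N).
Proof.
split; first split.
- by rewrite -att_diag1 attMstar_att_diag.
- move=> X Y /mem_attMstar[f ->] /mem_attMstar[g ->].
  by rewrite att_diagM attMstar_att_diag.
- by rewrite attAstarE attMstar_att_diag.
move=> T TS TK; apply/span_subvP => _ /mapP[i _ ->].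
rewrite attEstarE; exact: att_diag_subalgebra.
Qed.

Lemma theta_chain_th k : (k <= 2 * N)%N -> theta R F N M k = th (s ^+ k).
Proof.
move=> kN; rewrite /theta /chain_th mulrAC mulrA; congr (_ * _ / _).
by rewrite -{2}(subnK kN) exprD mulfK // expf_neq0 ?sqrtq_neq0.
Qed.

Lemma scale_neq0 : s ^+ M / (q - 1) != 0.
Proof. by rewrite mulf_neq0 ?invr_neq0 ?q1_neq0 ?expf_neq0 ?sqrtq_neq0. Qed.

(** The two forms of the constant agree because [(q - q^-1) / (q - 1) = (q + 1) / q]. *)
Lemma attA_chain_cubic :
  A *m A *m A *m K - (s ^+ 2 + s ^- 2 + 1) *: (A *m A *m K *m A)
    + (s ^+ 2 + s ^- 2 + 1) *: (A *m K *m A *m A) - K *m A *m A *m A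
  = ((s ^+ M / (q - 1)) ^+ 2 * s ^+ (2 * N) * (s ^+ 2 - s ^- 2) ^+ 2)
    *: (A *m K - K *m A).
Proof.
rewrite sqr_sqrtq attA_cubic //; congr (_ *: _).
have qX k : s ^+ (2 * k) = q ^+ k by rewrite exprM sqr_sqrtq.
rewrite expr_div_n -exprM mulnC !qX exprD.
move: q1_neq0 q_neq0 (q ^+ N) (q ^+ M) => q1 q0 r1 r2; field.
by rewrite q1 q0.
Qed.

Lemma attA_eigvalP (r : C) :
  eigval A r <-> exists2 k, (k <= 2 * N)%N & r = th (s ^+ k).
Proof.
have [P [d [uP AE]]] := attA_diagonalizable.
have filt := att_diag_filtered (fun i => (-1) ^+ i).
split=> [|[k kN ->]].
  exact: (eigval_chain sqrtq_gt1 scale_neq0 uP AE attA_chain_cubic filt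
    att_signK att_signA).
apply: (chain_eigvals sqrtq_gt1 scale_neq0 uP AE attA_chain_cubic filt
  att_signK att_signA N0) => //.
  exact: attA_eigenvector0.
exact: attA_eigenvector1.
Qed.

Lemma attA_tridiagonal (W : {vspace 'cV[C]_#|att_space h|}) k :
  (k <= 2 * N)%N ->
  (forall l, (l <= 2 * N)%N -> [\/ l = k, l = (k + 2)%N | k = (l + 2)%N] ->
     (mx_eigenspace A (th (s ^+ l)) <= W)%VS) ->
  (mxact K @: mx_eigenspace A (th (s ^+ k)) <= W)%VS.
Proof.
have [P [d [uP AE]]] := attA_diagonalizable.
have filt := att_diag_filtered (fun i => (-1) ^+ i).
move=> kN EW; apply/subvP => _ /memv_imgP[v vk ->]; rewrite mxactE.
exact: (chain_tridiagonal sqrtq_gt1 scale_neq0 uP AE attA_chain_cubic filt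
  att_signK att_signA kN EW vk).
Qed.

Lemma mxim_attE k : (k <= 2 * N)%N ->
  mxim (attE R h N M k) = mx_eigenspace A (th (s ^+ k)).
Proof.
move=> kN; have [P [d [uP AE]]] := attA_diagonalizable.
rewrite /attE (theta_chain_th kN) mxim_daddv_pi //.
rewrite (eq_bigr (fun j : 'I_(2 * N).+1 =>
  mx_eigenspace A (th (s ^+ j)))) => [|j _].
  exact: (chain_independent sqrtq_gt1 scale_neq0 uP AE).
by rewrite theta_chain_th // -ltnS.
Qed.

(** Since [A*] moves the index by at most one step of size 2, an ordering works as soon as [k + 2],
    when in range, comes immediately after [k]. Both orderings have this property, so the
    tridiagonal argument is made once. *)
Lemma dual_adjacency_indices (ks : seq nat) :
  uniq ks -> (forall k, (k \in ks) = (k <= 2 * N)%N) ->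
  (forall i, (i < size ks)%N -> (nth 0%N ks i + 2 <= 2 * N)%N ->
     (i.+1 < size ks)%N /\ nth 0%N ks i.+1 = (nth 0%N ks i + 2)%N) ->
  dual_adjacency A (attMstar R h N) K [seq mxim (attE R h N M k) | k <- ks].
Proof.
move=> ks_uniq mem_ks ks_step.
have eE : {in ks, forall k,
  mxim (attE R h N M k) = mx_eigenspace A (th (s ^+ k))}.
  by move=> k; rewrite mem_ks; apply: mxim_attE.
have ev k : k \in ks -> eigval A (th (s ^+ k)).
  by rewrite mem_ks => kN; apply/attA_eigvalP; exists k.
split; last 2 first.
- exact: attAstar_generates.
- have nthV i : (i < size ks)%N ->
      nth 0%VS [seq mxim (attE R h N M k) | k <- ks] i
      = mx_eigenspace A (th (s ^+ nth 0%N ks i)).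
    by move=> i_lt; rewrite (nth_map 0%N) // eE ?mem_nth.
  move: (size_map (fun k => mxim (attE R h N M k)) ks) nthV.
  move: [seq _ | _ <- _] => V -> nthV i i_lt.
  rewrite [X in (_ @: X <= _)%VS]nthV //.
  apply: attA_tridiagonal; first by rewrite -mem_ks mem_nth.
  move=> l lN [->|lE|lE].
  + by rewrite -nthV //; apply: subv_trans (addvSl _ _); apply: addvSr.
  + have [|i_lt' iE] := ks_step i i_lt; first by rewrite -lE.
    by rewrite lE -iE -nthV // addvSr.
  have lks : l \in ks by rewrite mem_ks.
  have l_lt : (index l ks < size ks)%N by rewrite index_mem.
  have := ks_step _ l_lt;
    rewrite nth_index // -lE -mem_ks mem_nth // => -[//|l_lt' /eqP].
  (* By uniqueness [i] is the successor of the position of [l], so entry [i] of the list prefixed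
     with [0] is the eigenspace of index [l]. *)
  rewrite nth_uniq // => /eqP <- /=.
  by rewrite -[l in th (s ^+ l)](nth_index 0%N lks) -nthV // -addvA addvSl.
split.
  have eI : {in ks &, injective (fun k => mxim (attE R h N M k))}.
    move=> k l kk lk E; have {}E :=
      etrans (esym (eE k kk)) (etrans E (eE l lk)).
    have [v v0 Av] := ev k kk.
    have : v \in mx_eigenspace A (th (s ^+ k)) by rewrite mem_mx_eigenspace Av.
    rewrite E mem_mx_eigenspace Av -subr_eq0 -scalerBl scaler_eq0 (negPf v0)
      orbF subr_eq0.
    move/eqP => kl; apply: (chain_th_inj sqrtq_gt1 scale_neq0 _ _ kl).
      by rewrite -mem_ks.
    by rewrite -mem_ks.
  by rewrite (map_inj_in_uniq eI).
move=> U; split=> [/mapP[k kk ->]|[a /leigenvalueP /attA_eigvalP[k kN ->] ->]].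
  exists (th (s ^+ k)); last exact: eE.
  by apply/leigenvalueP/ev.
have kk : k \in ks by rewrite mem_ks.
by apply/mapP; exists k => //; rewrite eE.
Qed.

End AttenuatedMatrices.

(** * The two index sequences and the orderings *)

Definition even_indices N := [seq (2 * i)%N | i <- iota 0 N.+1].

Definition odd_indices N := [seq (2 * i).+1 | i <- iota 0 N].

Lemma mem_even_indices N k :
  (k \in even_indices N) = ~~ odd k && (k <= 2 * N)%N.
Proof.
apply/mapP/andP => [[i + ->]|[ek kN]]; rewrite ?mem_iota; first by lia.
by exists k./2; rewrite ?mem_iota; lia.
Qed.

Lemma mem_odd_indices N k : (k \in odd_indices N) = odd k && (k <= 2 * N)%N.
Proof.
apply/mapP/andP => [[i + ->]|[ek kN]]; rewrite ?mem_iota; first by lia.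
by exists k./2; rewrite ?mem_iota; lia.
Qed.

Lemma uniq_even_indices N : uniq (even_indices N).
Proof. by rewrite map_inj_uniq ?iota_uniq // => i j; lia. Qed.

Lemma uniq_odd_indices N : uniq (odd_indices N).
Proof. by rewrite map_inj_uniq ?iota_uniq // => i j; lia. Qed.

Lemma nth_even_indices N i :
  (i < N.+1)%N -> nth 0%N (even_indices N) i = (2 * i)%N.
Proof. by move=> iN; rewrite (nth_map 0%N) ?size_iota // nth_iota. Qed.

Lemma nth_odd_indices N i : (i < N)%N -> nth 0%N (odd_indices N) i = (2 * i).+1.
Proof. by move=> iN; rewrite (nth_map 0%N) ?size_iota // nth_iota. Qed.

Lemma size_even_indices N : size (even_indices N) = N.+1.
Proof. by rewrite size_map size_iota. Qed.

Lemma size_odd_indices N : size (odd_indices N) = N.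
Proof. by rewrite size_map size_iota. Qed.

Theorem corollary10p3 (R : realType) (F : finFieldType) (N M : nat)
  (H : vectType F) (h : {vspace H}) :
  (0 < N)%N -> (0 < M)%N ->
  \dim (fullv : {vspace H}) = (N + M)%N -> \dim h = M ->
  dual_adjacency (attA R h) (attMstar R h N) (attAstar R h)
    (integral_part R h N M ++ half_integral_part R h N M)
  /\
  dual_adjacency (attA R h) (attMstar R h N) (attAstar R h)
    (half_integral_part R h N M ++ integral_part R h N M).
Proof.
move=> N0 M0 dimH dimh.
have eE : integral_part R h N M =
    [seq mxim (attE R h N M k) | k <- even_indices N].
  by rewrite -map_comp.
have oE : half_integral_part R h N M =
    [seq mxim (attE R h N M k) | k <- odd_indices N].
  by rewrite -map_comp.
have disj : has [in even_indices N] (odd_indices N) = false.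
  apply/negP => /hasP[k]; rewrite mem_odd_indices /= mem_even_indices.
  by case: odd.
rewrite eE oE -!map_cat; split; apply: dual_adjacency_indices => //.
- by rewrite cat_uniq uniq_even_indices uniq_odd_indices disj.
- move=> k; rewrite mem_cat mem_even_indices mem_odd_indices.
  by case: odd; rewrite ?orbF.
- move=> i; rewrite size_cat size_even_indices size_odd_indices !nth_cat.
  rewrite size_even_indices => i_lt.
  (* Nothing is required at the junction: the first block ends with the index [2N], and [2N + 2] is
     out of range. *)
  have [iN|Ni] := ltnP i N.+1.
    rewrite nth_even_indices // => iN2; have iN' : (i.+1 < N.+1)%N by lia.
    by rewrite iN' nth_even_indices //; lia.
  have -> : (i.+1 < N.+1)%N = false by lia.
  rewrite nth_odd_indices => [iN2|]; last by lia.
  by rewrite nth_odd_indices; lia.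
- by rewrite cat_uniq uniq_even_indices uniq_odd_indices has_sym disj.
- move=> k; rewrite mem_cat mem_even_indices mem_odd_indices.
  by case: odd; rewrite ?orbF.
- move=> i; rewrite size_cat size_even_indices size_odd_indices !nth_cat.
  rewrite size_odd_indices => i_lt.
  (* Here the first block ends with [2N - 1], and [2N + 1] is again out of range. *)
  have [iN|Ni] := ltnP i N.
    rewrite nth_odd_indices // => iN2; have iN' : (i.+1 < N)%N by lia.
    by rewrite iN' nth_odd_indices //; lia.
  have -> : (i.+1 < N)%N = false by lia.
  rewrite nth_even_indices => [iN2|]; last by lia.
  by rewrite nth_even_indices; lia.
Qed.
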